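(* Let $d\geq 1$ be an integer. A rank $r$ vector bundle $\mathcal{E}$ on $\mathbb{P}^1$ is an Ulrich bundle for $(\mathbb{P}^1,\mathcal{O}(d))$ if and only if $\mathcal{E}\simeq\mathcal{O}_{\mathbb{P}^1}(d-1)^{\oplus r}$.
   Context: We work over an algebraically closed field $k$ of characteristic $0$; $\mathbb{P}^1$ is the projective line over $k$. For a vector bundle $\mathcal{F}$ on $\mathbb{P}^1$ write $\mathcal{F}(i)=\mathcal{F}\otimes\mathcal{O}_{\mathbb{P}^1}(i)$ and $h^q(\mathcal{F})=\dim_k H^q(\mathbb{P}^1,\mathcal{F})$. A vector bundle $\mathcal{E}$ on $\mathbb{P}^1$ is an Ulrich bundle for $(\mathbb{P}^1,\mathcal{O}(d))$ if $h^q(\mathbb{P}^1,\mathcal{E}(-d))=0$ for every $q\in\mathbb{Z}$. *)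

(* Defs.v *)
From HB Require Import structures.
From mathcomp Require Import all_boot all_order all_algebra.
From mathcomp Require Import -(notations) mpoly.
From mathcomp Require Import all_classical topology.

Set Implicit Arguments.
Unset Strict Implicit.
Unset Printing Implicit Defensive.

Import GRing.Theory.
Local Open Scope classical_set_scope.
Local Open Scope quotient_scope.
Local Open Scope ring_scope.

(* P^1 is the classical variety of closed points (lines in k^2) with its       *)
(* Zariski topology and its sheaf of regular functions; over an algebraically *)
(* closed field its sheaves are the same as those of the scheme.              *)

Section ProjectiveLine.
Variable k : closedFieldType.

Definition vec := {v : 'rV[k]_2 | v != 0}.

Definition proportional (v w : vec) : bool :=
  `[< exists2 c : k, c != 0 & val w = c *: val v >].

Lemma proportional_refl : reflexive proportional.
Proof. by move=> v; apply/asboolP; exists 1; rewrite ?oner_neq0 ?scale1r. Qed.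

Lemma proportional_sym : ssrbool.symmetric proportional.
Proof.
have H v w : proportional v w -> proportional w v.
  move=> /asboolP[c c0 e]; apply/asboolP; exists c^-1; rewrite ?invr_eq0 //.
  by rewrite e scalerA mulVf // scale1r.
by move=> v w; apply/idP/idP; exact: H.
Qed.

Lemma proportional_trans : transitive proportional.
Proof.
move=> v u w /asboolP[c c0 e] /asboolP[c' c'0 e']; apply/asboolP.
by exists (c' * c); rewrite ?mulf_neq0 // e' e scalerA.
Qed.

Canonical proportional_equiv :=
  EquivRel proportional proportional_refl proportional_sym proportional_trans.

Definition P1 := {eq_quot proportional}.
HB.instance Definition _ := Choice.on P1.
HB.instance Definition _ := EqQuotient.on P1.

Definition coord (x : P1) : 'I_2 -> k := (val (repr x)) ord0.

Lemma coord_neq0 (x : P1) : exists i, coord x i != 0.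
Proof.
apply/existsP; apply: contraNT (valP (repr x)) => /existsPn H.
by apply/eqP/rowP => i; rewrite mxE; apply/eqP/negPn/H.
Qed.

(* Only the vanishing of [form_eval f x], and the quotients of two such values *)
(* in the same degree, are independent of the chosen representative of x.     *)
Definition form_eval n (f : dhomog 2 k n) (x : P1) : k :=
  meval (coord x) (mpoly_of_dhomog f).

Definition basic_open n (f : dhomog 2 k n) : set P1 :=
  [set x | form_eval f x != 0].

Definition zariski_open : set_system P1 := [set U : set P1 |
  forall x, U x ->
    exists n (f : dhomog 2 k n), basic_open f x /\ basic_open f `<=` U].

Definition form_mul m n (f : dhomog 2 k m) (g : dhomog 2 k n) :
    dhomog 2 k (m + n) :=
  DHomog (dhomogM (valP f) (valP g)).

Lemma form_mulE m n (f : dhomog 2 k m) (g : dhomog 2 k n) x :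
  form_eval (form_mul f g) x = form_eval f x * form_eval g x.
Proof. by rewrite /form_eval /= mevalM. Qed.

Lemma form_addE n (f g : dhomog 2 k n) x :
  form_eval (f + g) x = form_eval f x + form_eval g x.
Proof. by rewrite /form_eval /= mevalD. Qed.

Lemma form_oppE n (f : dhomog 2 k n) x :
  form_eval (- f) x = - form_eval f x.
Proof. by rewrite /form_eval /= mevalN. Qed.

Definition form_one : dhomog 2 k 0 := DHomog (dhomog1 _ _).

Lemma form_oneE x : form_eval form_one x = 1.
Proof. by rewrite /form_eval /= meval1. Qed.

Definition form_X (i : 'I_2) : dhomog 2 k 1.
Proof.
apply: (@DHomog 2 k 1 (mpolyX k (mnm1 i))).
by rewrite dhomogX; apply/eqP; exact: mdeg1.
Defined.

Lemma form_XE i x : form_eval (form_X i) x = coord x i.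
Proof. by rewrite /form_eval /= mevalXU. Qed.

Lemma zariski_openT : zariski_open setT.
Proof.
move=> x _; exists 0%N, form_one; split => //.
by rewrite /basic_open /= form_oneE oner_neq0.
Qed.

Lemma zariski_openI : setI_closed zariski_open.
Proof.
move=> U V oU oV x [/oU[m [f [fx fU]]] /oV[n [g [gx gV]]]].
exists (m + n)%N, (form_mul f g); split.
  by rewrite /basic_open /= form_mulE mulf_neq0.
by move=> y; rewrite /basic_open /= form_mulE mulf_eq0 negb_or => /andP[/fU ? /gV ?].
Qed.

Lemma zariski_open_bigcup (I : Type) (F : I -> set P1) :
  (forall i, zariski_open (F i)) -> zariski_open (\bigcup_i F i).
Proof.
move=> oF x [i _ /(oF i)[n [f [fx fF]]]]; exists n, f; split => //.
by move=> y /fF ?; exists i.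
Qed.

HB.instance Definition _ := isOpenTopological.Build P1
  zariski_openT zariski_openI zariski_open_bigcup.

Lemma openE_P1 (U : set P1) : open U = zariski_open U.
Proof. by []. Qed.

End ProjectiveLine.

Section StructureSheaf.
Variable k : closedFieldType.

Record opens := Opens { oset :> set (P1 k); _ : open oset }.

Lemma oset_open (U : opens) : open U. Proof. by case: U. Qed.
Arguments oset_open : clear implicits.

Definition opT : opens := Opens openT.

Definition opI (U V : opens) : opens := Opens (openI (oset_open U) (oset_open V)).

Lemma chart_open (i : 'I_2) : open (basic_open (form_X k i)).
Proof. by rewrite openE_P1 => x hx; exists 1%N, (form_X k i); split=> // y. Qed.
Arguments chart_open : clear implicits.

(* The affine chart where the i-th homogeneous coordinate does not vanish. *)
Definition chart (i : 'I_2) : opens := Opens (chart_open i).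

Lemma chartP (i : 'I_2) x : oset (chart i) x <-> coord x i != 0.
Proof. by rewrite /chart /= /basic_open /= form_XE. Qed.

Definition regular (U : opens) (f : set_type U -> k) : Prop :=
  forall x : set_type U, exists V : opens, oset V (val x) /\
    exists n (p q : dhomog 2 k n), forall y : set_type U, oset V (val y) ->
      form_eval q (val y) != 0 /\
      f y = form_eval p (val y) / form_eval q (val y).

Definition regular_pred (U : opens) : {pred (set_type U -> k)} :=
  fun f => `[< regular f >].
Arguments regular_pred : clear implicits.

Lemma regular_subring (U : opens) : subring_closed (regular_pred U).
Proof.
split=> [|f g /asboolP rf /asboolP rg|f g /asboolP rf /asboolP rg].
- apply/asboolP => x; exists opT; split => //; exists 0%N, (form_one k), (form_one k).
  by move=> y _; rewrite form_oneE oner_neq0 divr1.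
- apply/asboolP => x; have [V [Vx [m [p [q H]]]]] := rf x.
  have [V' [V'x [n [p' [q' H']]]]] := rg x.
  exists (opI V V'); split => //.
  exists (m + n)%N, (form_mul p q' - form_mul q p'), (form_mul q q').
  move=> y [/H[q0 fE] /H'[q'0 gE]]; rewrite form_addE form_oppE !form_mulE.
  split; first by rewrite mulf_neq0.
  have -> : (f - g) y = f y - g y by [].
  by rewrite fE gE -mulNr addf_div // mulNr [form_eval p' _ * _]mulrC.
- apply/asboolP => x; have [V [Vx [m [p [q H]]]]] := rf x.
  have [V' [V'x [n [p' [q' H']]]]] := rg x.
  exists (opI V V'); split => //.
  exists (m + n)%N, (form_mul p p'), (form_mul q q').
  move=> y [/H[q0 fE] /H'[q'0 gE]]; rewrite !form_mulE.
  split; first by rewrite mulf_neq0.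
  have -> : (f * g) y = f y * g y by [].
  by rewrite fE gE mulf_div.
Qed.

HB.instance Definition _ U :=
  GRing.isSubringClosed.Build _ (regular_pred U) (regular_subring U).

Record regfun (U : opens) := RegFun {
  rfun :> set_type U -> k;
  _ : rfun \in regular_pred U }.

HB.instance Definition _ U := [isSub for @rfun U].
HB.instance Definition _ U := [Choice of regfun U by <:].
HB.instance Definition _ (U : opens) := GRing.SubChoice_isSubComPzRing.Build
  (set_type U -> k) (regular_pred U) (regfun U) (regular_subring U).

Lemma regfunP U (f g : regfun U) : (forall y, f y = g y) <-> f = g.
Proof. by split=> [H|->//]; apply/val_inj/funext. Qed.

Definition incl (U V : opens) (VU : V `<=` U) (y : set_type V) : set_type U :=
  SigSub (mem_set (VU _ (set_mem (valP y)))).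

Lemma rres_subproof (U V : opens) (VU : V `<=` U) (f : regfun U) :
  (f \o incl VU) \in regular_pred V.
Proof.
have /asboolP rf := valP f; apply/asboolP => x.
have [W [Wx [n [p [q H]]]]] := rf (incl VU x).
by exists W; split=> //; exists n, p, q => y Wy; exact: (H (incl VU y) Wy).
Qed.

Definition rres (U V : opens) (VU : V `<=` U) (f : regfun U) : regfun V :=
  RegFun (rres_subproof VU f).

Lemma const_subproof (U : opens) (a : k) : (fun=> a) \in regular_pred U.
Proof.
apply/asboolP => x; exists opT; split=> //; exists 0%N, (a *: form_one k), (form_one k).
move=> y _; rewrite form_oneE oner_neq0 divr1; split=> //.
by rewrite /form_eval /= mevalZ meval1 mulr1.
Qed.

Definition const (U : opens) (a : k) : regfun U := RegFun (const_subproof U a).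

Lemma ratio_subproof (i j : 'I_2) (U : opens) : U `<=` chart j ->
  (fun y : set_type U => coord (val y) i / coord (val y) j) \in regular_pred U.
Proof.
move=> Uj; apply/asboolP => x; exists opT; split=> //.
exists 1%N, (form_X k i), (form_X k j) => y _; rewrite !form_XE; split=> //.
by apply/chartP/Uj/set_mem/valP.
Qed.

Definition ratio (i j : 'I_2) (U : opens) (Uj : U `<=` chart j) : regfun U :=
  RegFun (ratio_subproof i Uj).

End StructureSheaf.

Arguments oset_open {k} U.
Arguments chart_open k i : clear implicits.
Arguments regular_pred {k} U.

Section Modules.
Variable k : closedFieldType.
Implicit Types U V W : opens k.

Definition covers (I : Type) (W : I -> opens k) U : Prop :=
  U `<=` \bigcup_i (W i).

Lemma opIl U V : opI U V `<=` U. Proof. by move=> x []. Qed.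
Lemma opIr U V : opI U V `<=` V. Proof. by move=> x []. Qed.

Record omodule := OModule {
  sec : forall U, lmodType (regfun U);
  res : forall U V, V `<=` U -> sec U -> sec V;
  resD : forall U V (VU : V `<=` U) s t, res VU (s + t) = res VU s + res VU t;
  resZ : forall U V (VU : V `<=` U) (f : regfun U) s,
    res VU (f *: s) = rres VU f *: res VU s;
  res_id : forall U (UU : U `<=` U) s, res UU s = s;
  res_comp : forall U V W (VU : V `<=` U) (WV : W `<=` V) (WU : W `<=` U) s,
    res WV (res VU s) = res WU s;
  sec_ext : forall U (I : Type) (W : I -> opens k) (WU : forall i, W i `<=` U),
    covers W U ->
    forall s t, (forall i, res (WU i) s = res (WU i) t) -> s = t;
  sec_glue : forall U (I : Type) (W : I -> opens k) (WU : forall i, W i `<=` U),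
    covers W U ->
    forall s : (forall i, sec (W i)),
    (forall i j, res (@opIl (W i) (W j)) (s i) = res (@opIr (W i) (W j)) (s j)) ->
    exists t, forall i, res (WU i) t = s i }.

Section ModTheory.
Variable F : omodule.

Lemma res0 U V (VU : V `<=` U) : res VU (0 : sec F U) = 0.
Proof. by apply: (addrI (res VU (0 : sec F U))); rewrite -resD !addr0. Qed.

Lemma resN U V (VU : V `<=` U) (s : sec F U) : res VU (- s) = - res VU s.
Proof. by apply: (addrI (res VU s)); rewrite -resD !subrr res0. Qed.

End ModTheory.

(* [phi V] matters only for V contained in U. *)
Definition hom_on U (F G : omodule) (phi : forall V, sec F V -> sec G V) : Prop :=
  forall V, V `<=` U ->
  [/\ forall s t, phi V (s + t) = phi V s + phi V t,
      forall (f : regfun V) s, phi V (f *: s) = f *: phi V s &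
      forall W (WV : W `<=` V) s, phi W (res WV s) = res WV (phi V s)].

Definition iso_on U (F G : omodule) : Prop :=
  exists2 phi : (forall V, sec F V -> sec G V),
    hom_on U phi & forall V, V `<=` U -> bijective (phi V).

Definition iso (F G : omodule) : Prop := iso_on (opT k) F G.

Section Regfun.

Lemma rresE U V (VU : V `<=` U) (f : regfun U) y : rres VU f y = f (incl VU y).
Proof. by []. Qed.

Lemma rresD U V (VU : V `<=` U) f g : rres VU (f + g) = rres VU f + rres VU g.
Proof. exact/regfunP. Qed.

Lemma rresM U V (VU : V `<=` U) f g : rres VU (f * g) = rres VU f * rres VU g.
Proof. exact/regfunP. Qed.

Lemma rres1 U V (VU : V `<=` U) : rres VU 1 = 1.
Proof. exact/regfunP. Qed.

Lemma rresX U V (VU : V `<=` U) f n : rres VU (f ^+ n) = rres VU f ^+ n.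
Proof. by elim: n => [|n IH]; rewrite ?expr0 ?rres1 // !exprS rresM IH. Qed.

Lemma rres_id U (UU : U `<=` U) f : rres UU f = f.
Proof. by apply/regfunP => y; rewrite rresE; congr (rfun f _); apply/val_inj. Qed.

Lemma rres_comp U V W (VU : V `<=` U) (WV : W `<=` V) (WU : W `<=` U) f :
  rres WV (rres VU f) = rres WU f.
Proof. by apply/regfunP => y; rewrite !rresE; congr (rfun f _); apply/val_inj. Qed.

Lemma regfun_ext U (I : Type) (W : I -> opens k) (WU : forall i, W i `<=` U) :
  covers W U ->
  forall s t : regfun U, (forall i, rres (WU i) s = rres (WU i) t) -> s = t.
Proof.
move=> cW s t st; apply/regfunP => y; have [i _ Wy] := cW _ (set_mem (valP y)).
have /regfunP/(_ (SigSub (mem_set Wy))) := st i; rewrite !rresE.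
suff -> : incl (WU i) (SigSub (mem_set Wy)) = y by [].
exact/val_inj.
Qed.

Lemma regfun_glue U (I : Type) (W : I -> opens k) (WU : forall i, W i `<=` U) :
  covers W U ->
  forall s : (forall i, regfun (W i)),
  (forall i j, rres (@opIl (W i) (W j)) (s i) = rres (@opIr (W i) (W j)) (s j)) ->
  exists t, forall i, rres (WU i) t = s i.
Proof.
move=> cW s ss.
have sE i j x (xi : x \in oset (W i)) (xj : x \in oset (W j)) :
    s i (SigSub xi) = s j (SigSub xj).
  have xij : x \in oset (opI (W i) (W j)) by rewrite inE; split; exact/set_mem.
  have /regfunP/(_ (SigSub xij)) := ss i j; rewrite !rresE.
  have -> : incl (@opIl (W i) (W j)) (SigSub xij) = SigSub xi by exact/val_inj.
  by have -> : incl (@opIr (W i) (W j)) (SigSub xij) = SigSub xj by exact/val_inj.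
have /choice[i Wi] (y : set_type U) : exists i, val y \in oset (W i).
  by have [i _ Wy] := cW _ (set_mem (valP y)); exists i; exact/mem_set.
pose t (y : set_type U) := s (i y) (SigSub (Wi y)).
have rt : t \in regular_pred U.
  apply/asboolP => x; have /asboolP/(_ (SigSub (Wi x))) := valP (s (i x)).
  move=> [V [Vx [n [p [q H]]]]].
  exists (opI V (W (i x))); split; first by split=> //; exact/set_mem.
  exists n, p, q => y [Vy Wy].
  rewrite /t (sE _ (i x) _ _ (mem_set Wy)).
  exact: (H (SigSub (mem_set Wy)) Vy).
exists (RegFun rt) => j; apply/regfunP => -[y yj]; rewrite rresE.
exact: sE.
Qed.

End Regfun.

Definition structure_sheaf : omodule.
Proof.
refine (@OModule (fun U => (regfun U)^o) (fun U V VU f => rres VU f) _ _ _ _ _ _).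
- exact: rresD.
- exact: rresM.
- exact: rres_id.
- exact: rres_comp.
- exact: regfun_ext.
- exact: regfun_glue.
Defined.

Section DirectSum.
Variables (r : nat) (F : omodule).

Definition dsum : omodule.
Proof.
refine (@OModule (fun U => {ffun 'I_r -> sec F U})
  (fun U V VU s => [ffun a => res VU (s a)]) _ _ _ _ _ _).
- by move=> U V VU s t; apply/ffunP => a; rewrite !ffunE resD.
- by move=> U V VU f s; apply/ffunP => a; rewrite !ffunE resZ.
- by move=> U UU s; apply/ffunP => a; rewrite !ffunE res_id.
- by move=> U V W VU WV WU s; apply/ffunP => a; rewrite !ffunE (res_comp _ _ WU).
- move=> U I W WU cW s t st; apply/ffunP => a; apply: (@sec_ext F U I W WU cW) => i.
  by have /ffunP/(_ a) := st i; rewrite !ffunE.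
- move=> U I W WU cW s ss.
  have /choice[t tE] a : exists t, forall i, res (WU i) t = s i a.
    apply: (@sec_glue F U I W WU cW (fun i => s i a)) => i j.
    by have /ffunP/(_ a) := ss i j; rewrite !ffunE.
  by exists [ffun a => t a] => i; apply/ffunP => a; rewrite !ffunE tE.
Defined.

End DirectSum.

End Modules.

Section Twist.
Variable k : closedFieldType.
Implicit Types U V W : opens k.

Local Notation C0 := (chart k ord0).
Local Notation C1 := (chart k ord_max).
Local Notation C01 := (opI C0 C1).

Lemma opI_sub U V (VU : V `<=` U) (C : opens k) : opI V C `<=` opI U C.
Proof. by move=> x [/VU]. Qed.

Lemma covers_opI U (I : Type) (W : I -> opens k) (C : opens k) :
  covers W U -> covers (fun i => opI (W i) C) (opI U C).
Proof. by move=> cW x [/cW[i _ Wx] Cx]; exists i. Qed.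

Lemma opIC01_0 U : opI U C01 `<=` opI U C0.
Proof. by move=> x [? []]. Qed.

Lemma opIC01_1 U : opI U C01 `<=` opI U C1.
Proof. by move=> x [? []]. Qed.

Lemma sub0 U : opI U C01 `<=` C0. Proof. by move=> x [? []]. Qed.
Lemma sub1 U : opI U C01 `<=` C1. Proof. by move=> x [? []]. Qed.

(* The function (x_1 / x_0)^n. *)
Definition trans (n : int) U (U0 : U `<=` C0) (U1 : U `<=` C1) : regfun U :=
  match n with
  | Posz m => ratio ord_max U0 ^+ m
  | Negz m => ratio ord0 U1 ^+ m.+1
  end.

Lemma rres_trans n U V (VU : V `<=` U) (U0 : U `<=` C0) (U1 : U `<=` C1)
    (V0 : V `<=` C0) (V1 : V `<=` C1) :
  rres VU (@trans n U U0 U1) = @trans n V V0 V1.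
Proof.
by case: n => m /=; rewrite rresX; congr (_ ^+ _); apply/regfunP.
Qed.

Lemma ratioK U (U0 : U `<=` C0) (U1 : U `<=` C1) :
  ratio ord_max U0 * ratio ord0 U1 = 1.
Proof.
apply/regfunP => y /=.
have /chartP y0 := U0 _ (set_mem (valP y)).
have /chartP y1 := U1 _ (set_mem (valP y)).
change (ratio ord_max U0 y * ratio ord0 U1 y = 1).
by rewrite /= mulf_div [X in _ / X]mulrC divff // mulf_neq0.
Qed.

Lemma transN n U (U0 : U `<=` C0) (U1 : U `<=` C1) :
  trans n U0 U1 * trans (- n) U0 U1 = 1.
Proof.
case: n => [[|m]|m]; rewrite /= ?mulr1 //.
  by rewrite -exprMn ratioK expr1n.
by rewrite mulrC -exprMn ratioK expr1n.
Qed.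

Section TwistModule.
Variables (n : int) (F : omodule k).

Section Sections.
Variable U : opens k.

Definition tw_pred : {pred (sec F (opI U C0) * sec F (opI U C1))} := fun p =>
  `[< res (@opIC01_0 U) p.1 = trans n (@sub0 U) (@sub1 U) *: res (@opIC01_1 U) p.2 >].

Lemma tw_zmod : zmod_closed tw_pred.
Proof.
split=> [|p q /asboolP pE /asboolP qE]; apply/asboolP.
  by rewrite /= !res0 scaler0.
by rewrite /= !resD !resN pE qE scalerDr scalerN.
Qed.

HB.instance Definition _ := GRing.isZmodClosed.Build _ tw_pred tw_zmod.

Record twsec := TwSec {
  tws : sec F (opI U C0) * sec F (opI U C1);
  _ : tws \in tw_pred }.

HB.instance Definition _ := [isSub for tws].
HB.instance Definition _ := [Choice of twsec by <:].
HB.instance Definition _ := [SubChoice_isSubZmodule of twsec by <:].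

Lemma twP (s t : twsec) :
  (tws s).1 = (tws t).1 -> (tws s).2 = (tws t).2 -> s = t.
Proof.
move=> e1 e2; apply/val_inj => /=.
by rewrite [tws s]surjective_pairing [tws t]surjective_pairing e1 e2.
Qed.

Lemma tw_eq (s : twsec) : res (@opIC01_0 U) (tws s).1 =
  trans n (@sub0 U) (@sub1 U) *: res (@opIC01_1 U) (tws s).2.
Proof. exact/asboolP/(valP s). Qed.

Lemma twscale_subproof (f : regfun U) (s : twsec) :
  (rres (@opIl k U C0) f *: (tws s).1, rres (@opIl k U C1) f *: (tws s).2)
    \in tw_pred.
Proof.
apply/asboolP; rewrite /= !resZ tw_eq !scalerA !(rres_comp _ _ (@opIl k U C01)).
by rewrite mulrC.
Qed.

Definition twscale (f : regfun U) (s : twsec) : twsec :=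
  TwSec (twscale_subproof f s).

Lemma twscaleA f g s : twscale f (twscale g s) = twscale (f * g) s.
Proof. by apply: twP; rewrite /= scalerA rresM. Qed.

Lemma twscale1 : left_id 1 twscale.
Proof. by move=> s; apply: twP; rewrite /= rres1 scale1r. Qed.

Lemma twscaleDr : right_distributive twscale +%R.
Proof. by move=> f s t; apply: twP; rewrite /= scalerDr. Qed.

Lemma twscaleDl s : {morph twscale^~ s : f g / f + g}.
Proof. by move=> f g; apply: twP; rewrite /= rresD scalerDl. Qed.

HB.instance Definition _ := GRing.Zmodule_isLmodule.Build (regfun U) twsec
  twscaleA twscale1 twscaleDr twscaleDl.

End Sections.

Lemma twres_subproof U V (VU : V `<=` U) (s : twsec U) :
  (res (opI_sub VU (C:=C0)) (tws s).1, res (opI_sub VU (C:=C1)) (tws s).2)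
    \in @tw_pred V.
Proof.
apply/asboolP => /=.
rewrite !(res_comp _ _ (subset_trans (opI_sub VU (C:=C01)) (@opIC01_0 U))).
rewrite !(res_comp _ _ (subset_trans (opI_sub VU (C:=C01)) (@opIC01_1 U))).
rewrite -(res_comp (@opIC01_0 U) (opI_sub VU (C:=C01))) tw_eq resZ.
rewrite (rres_trans _ _ _ _ (@sub0 V) (@sub1 V)); congr (_ *: _).
exact: res_comp.
Qed.

Definition twres U V (VU : V `<=` U) (s : twsec U) : twsec V :=
  TwSec (twres_subproof VU s).

(* F(n) as the module glued from F on the two standard charts: a section is a *)
(* pair (a, b) of sections over the traces of the charts, namely the quotients *)
(* by x_0^n and x_1^n of a section of F(n); hence a = (x_1 / x_0)^n b.         *)
Definition twist : omodule k.
Proof.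
refine (@OModule k twsec twres _ _ _ _ _ _).
- by move=> U V VU s t; apply: twP; rewrite /= resD.
- move=> U V VU f s; apply: twP; rewrite /= resZ; congr (_ *: _).
    by rewrite !(rres_comp _ _ (subset_trans (@opIl k V C0) VU)).
  by rewrite !(rres_comp _ _ (subset_trans (@opIl k V C1) VU)).
- by move=> U UU s; apply: twP; rewrite /= res_id.
- by move=> U V W VU WV WU s; apply: twP; exact: res_comp.
- move=> U I W WU cW s t st; apply: twP.
    apply: (@sec_ext k F _ I (fun i => opI (W i) C0) (fun i => opI_sub (WU i) (C:=C0))
      (covers_opI cW)) => i.
    by have /(congr1 (fun s => (tws s).1)) := st i.
  apply: (@sec_ext k F _ I (fun i => opI (W i) C1) (fun i => opI_sub (WU i) (C:=C1))
    (covers_opI cW)) => i.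
  by have /(congr1 (fun s => (tws s).2)) := st i.
- move=> U I W WU cW s ss.
  have subIW i j C : opI (opI (W i) C) (opI (W j) C) `<=` opI (opI (W i) (W j)) C.
    by move=> x [[? ?] []].
  have sa i j : res (@opIl k (opI (W i) C0) (opI (W j) C0)) (tws (s i)).1 =
                res (@opIr k (opI (W i) C0) (opI (W j) C0)) (tws (s j)).1.
    move: (congr1 (fun s => res (@subIW i j C0) (tws s).1) (ss i j)) => /=.
    rewrite (res_comp _ _ (@opIl k (opI (W i) C0) (opI (W j) C0))).
    by rewrite (res_comp _ _ (@opIr k (opI (W i) C0) (opI (W j) C0))).
  have sb i j : res (@opIl k (opI (W i) C1) (opI (W j) C1)) (tws (s i)).2 =
                res (@opIr k (opI (W i) C1) (opI (W j) C1)) (tws (s j)).2.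
    move: (congr1 (fun s => res (@subIW i j C1) (tws s).2) (ss i j)) => /=.
    rewrite (res_comp _ _ (@opIl k (opI (W i) C1) (opI (W j) C1))).
    by rewrite (res_comp _ _ (@opIr k (opI (W i) C1) (opI (W j) C1))).
  have [a aE] := sec_glue (fun i => opI_sub (WU i) (C:=C0)) (covers_opI cW) sa.
  have [b bE] := sec_glue (fun i => opI_sub (WU i) (C:=C1)) (covers_opI cW) sb.
  have ab : (a, b) \in @tw_pred U.
    apply/asboolP => /=.
    apply: (@sec_ext k F _ I (fun i => opI (W i) C01)
      (fun i => opI_sub (WU i) (C:=C01)) (covers_opI cW)) => i.
    rewrite resZ (rres_trans _ _ _ _ (@sub0 (W i)) (@sub1 (W i))).
    rewrite (res_comp _ _ (subset_trans (@opIC01_0 (W i)) (opI_sub (WU i) (C:=C0)))).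
    rewrite (res_comp _ _ (subset_trans (@opIC01_1 (W i)) (opI_sub (WU i) (C:=C1)))).
    rewrite -(res_comp (opI_sub (WU i) (C:=C0)) (@opIC01_0 (W i))) aE.
    by rewrite -(res_comp (opI_sub (WU i) (C:=C1)) (@opIC01_1 (W i))) bE tw_eq.
  by exists (TwSec ab) => i; apply: twP; rewrite /= ?aE ?bE.
Defined.

Definition tw0 U (s : sec twist U) : sec F (opI U C0) := (@tws U s).1.
Definition tw1 U (s : sec twist U) : sec F (opI U C1) := (@tws U s).2.

End TwistModule.

Definition O_P1 (n : int) : omodule k := twist n (structure_sheaf k).

End Twist.

Section Tensor.
Variable k : closedFieldType.
Implicit Types U V W : opens k.

Local Notation C0 := (chart k ord0).
Local Notation C1 := (chart k ord_max).
Local Notation C01 := (opI C0 C1).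

Definition bilin (F G H : omodule k)
    (b : forall U, sec F U -> sec G U -> sec H U) : Prop := forall U,
  [/\ forall s s' t, b U (s + s') t = b U s t + b U s' t,
      forall s t t', b U s (t + t') = b U s t + b U s t',
      forall (f : regfun U) s t,
        b U (f *: s) t = f *: b U s t /\ b U s (f *: t) = f *: b U s t &
      forall V (VU : V `<=` U) s t, res VU (b U s t) = b V (res VU s) (res VU t)].

(* T, with the universal bilinear map b, is the tensor product of F and G.    *)
Definition is_tensor (F G T : omodule k)
    (b : forall U, sec F U -> sec G U -> sec T U) : Prop :=
  bilin b /\
  forall (H : omodule k) (g : forall U, sec F U -> sec G U -> sec H U), bilin g ->
  exists phi : (forall U, sec T U -> sec H U),
    [/\ hom_on (opT k) phi, forall U s t, phi U (b U s t) = g U s t &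
        forall psi : (forall U, sec T U -> sec H U), hom_on (opT k) psi ->
          (forall U s t, psi U (b U s t) = g U s t) ->
          forall U s, psi U s = phi U s].

Section TwistTensor.
Variables (n : int) (F : omodule k).

Lemma twmul_subproof U (s : sec F U) (t : sec (O_P1 k n) U) :
  (tw0 t *: res (@opIl k U C0) s, tw1 t *: res (@opIl k U C1) s)
    \in @tw_pred k n F U.
Proof.
apply/asboolP; rewrite /= !resZ !(res_comp _ _ (@opIl k U C01)) scalerA.
by congr (_ *: _); exact: (tw_eq t).
Qed.

Definition twmul U (s : sec F U) (t : sec (O_P1 k n) U) : sec (twist n F) U :=
  TwSec (twmul_subproof s t).

Lemma twmul_bilin : bilin twmul.
Proof.
move=> U; split=> [s s' t|s t t'|f s t|V VU s t].
- by apply: twP; rewrite /= resD scalerDr.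
- by apply: twP; rewrite /= scalerDl.
- split; apply: twP; rewrite /= ?resZ ?scalerA //.
  + by rewrite mulrC.
  + by rewrite mulrC.
- apply: twP; rewrite /= resZ; congr (_ *: _).
  + rewrite (res_comp _ _ (subset_trans (@opIl k V C0) VU)).
    by rewrite (res_comp _ _ (subset_trans (@opIl k V C0) VU)).
  + rewrite (res_comp _ _ (subset_trans (@opIl k V C1) VU)).
    by rewrite (res_comp _ _ (subset_trans (@opIl k V C1) VU)).
Qed.

(* Generators x_0^n and x_1^n of O(n) on the two charts. *)
Lemma gen0_subproof U (U0 : U `<=` C0) :
  (1, trans (- n) (subset_trans (@opIl k U C1) U0) (@opIr k U C1))
    \in @tw_pred k n (structure_sheaf k) U.
Proof.
apply/asboolP => /=; rewrite rres1.
rewrite (rres_trans _ _ _ _ (@sub0 k U) (@sub1 k U)).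
by symmetry; exact: transN.
Qed.

Definition gen0 U (U0 : U `<=` C0) : sec (O_P1 k n) U := TwSec (gen0_subproof U0).

Lemma gen1_subproof U (U1 : U `<=` C1) :
  (trans n (@opIr k U C0) (subset_trans (@opIl k U C0) U1), 1)
    \in @tw_pred k n (structure_sheaf k) U.
Proof.
apply/asboolP => /=; rewrite rres1 [_ *: _]mulr1.
exact: (rres_trans _ _ _ _ (@sub0 k U) (@sub1 k U)).
Qed.

Definition gen1 U (U1 : U `<=` C1) : sec (O_P1 k n) U := TwSec (gen1_subproof U1).

Lemma res_gen0 U V (VU : V `<=` U) (U0 : U `<=` C0) (V0 : V `<=` C0) :
  res VU (gen0 U0) = gen0 V0.
Proof. by apply: twP; rewrite /= ?rres1 //; exact: rres_trans. Qed.

Lemma res_gen1 U V (VU : V `<=` U) (U1 : U `<=` C1) (V1 : V `<=` C1) :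
  res VU (gen1 U1) = gen1 V1.
Proof. by apply: twP; rewrite /= ?rres1 //; exact: rres_trans. Qed.

Lemma gen01 U (U0 : U `<=` C0) (U1 : U `<=` C1) :
  gen1 U1 = trans n U0 U1 *: gen0 U0.
Proof.
apply: twP => /=.
  by rewrite [_ *: _]mulr1; symmetry; exact: rres_trans.
rewrite (rres_trans _ _ _ _ (subset_trans (@opIl k U C1) U0) (@opIr k U C1)).
by symmetry; exact: transN.
Qed.

Lemma tw_gen0 U (s : sec (twist n F) U) :
  res (@opIl k U C0) s = twmul (tw0 s) (gen0 (@opIr k U C0)).
Proof.
apply: twP => /=; first by rewrite scale1r; congr (res _ _); exact: Prop_irrelevance.
pose V := opI (opI U C0) C1.
have V01 : V `<=` opI U C01 by move=> x [[? ?] ?].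
have V0 : V `<=` C0 by move=> x [[? ?] ?].
have := congr1 (res V01) (tw_eq s).
rewrite resZ (rres_trans _ _ _ _ V0 (@opIr k _ C1)).
rewrite (res_comp _ _ (@opIl k (opI U C0) C1)).
rewrite (res_comp _ _ (opI_sub (@opIl k U C0) (C:=C1))) => e.
have := congr1 (fun u => trans (- n) V0 (@opIr k _ C1) *: u) e.
rewrite scalerA mulrC transN scale1r => <-.
by congr (trans _ _ _ *: _); exact: Prop_irrelevance.
Qed.

Lemma tw_gen1 U (s : sec (twist n F) U) :
  res (@opIl k U C1) s = twmul (tw1 s) (gen1 (@opIr k U C1)).
Proof.
apply: twP => /=; last by rewrite scale1r; congr (res _ _); exact: Prop_irrelevance.
pose V := opI (opI U C1) C0.
have V01 : V `<=` opI U C01 by move=> x [[? ?] ?].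
have V1 : V `<=` C1 by move=> x [[? ?] ?].
have := congr1 (res V01) (tw_eq s).
rewrite resZ (rres_trans _ _ _ _ (@opIr k _ C0) V1).
rewrite (res_comp _ _ (@opIl k (opI U C1) C0)).
rewrite (res_comp _ _ (opI_sub (@opIl k U C1) (C:=C0))) => ->.
by congr (trans _ _ _ *: _); exact: Prop_irrelevance.
Qed.

End TwistTensor.

Section TwistTensorUniv.
Variables (n : int) (F : omodule k).

Lemma O_gen0 U (t : sec (O_P1 k n) U) :
  res (@opIl k U C0) t = tw0 t *: gen0 n (@opIr k U C0).
Proof. by apply: etrans (tw_gen0 t) _; apply: twP; exact: mulrC. Qed.

Lemma O_gen1 U (t : sec (O_P1 k n) U) :
  res (@opIl k U C1) t = tw1 t *: gen1 n (@opIr k U C1).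
Proof. by apply: etrans (tw_gen1 t) _; apply: twP; exact: mulrC. Qed.

(* O(n) is [twist n O], and F(n) is the tensor product of F and O(n). *)
Lemma twist_tensor : is_tensor (@twmul n F).
Proof.
split; first exact: twmul_bilin.
move=> H g gB.
have gr U V (VU : V `<=` U) s t : res VU (g U s t) = g V (res VU s) (res VU t).
  by have [_ _ _] := gB U; apply.
have gDl U s s' t : g U (s + s') t = g U s t + g U s' t by have [] := gB U.
have gZl U f s t : g U (f *: s) t = f *: g U s t.
  by have [_ _ /(_ f s t)[]] := gB U.
have gZr U f s t : g U s (f *: t) = f *: g U s t.
  by have [_ _ /(_ f s t)[]] := gB U.
pose C (i : bool) := if i then C1 else C0.
pose W U (i : bool) := opI U (C i).
have cW U : covers (W U) U.
  move=> x Ux; have [i /chartP xi] := coord_neq0 x.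
  have [e|e] : i = ord0 \/ i = ord_max.
    by case: i {xi} => -[|[|//]] hi; [left|right]; apply/val_inj.
    by exists false => //; split=> //; rewrite e in xi.
  by exists true => //; split=> //; rewrite e in xi.
pose loc U (s : sec (twist n F) U) (i : bool) : sec H (W U i) :=
  match i with
  | true => g _ (tw1 s) (gen1 n (@opIr k U C1))
  | false => g _ (tw0 s) (gen0 n (@opIr k U C0))
  end.
have locE (psi : forall U, sec (twist n F) U -> sec H U) :
    hom_on (opT k) psi -> (forall U s t, psi U (twmul s t) = g U s t) ->
    forall U s i, res (@opIl k U (C i)) (psi U s) = loc U s i.
  move=> psiH psiE U s i; have [//|_ _ psir] := psiH U.
  by rewrite -psir; case: i; rewrite /= -psiE -?tw_gen1 -?tw_gen0.
have loc01 U s : res (@opIl k (W U false) (W U true)) (loc U s false) =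
                 res (@opIr k (W U false) (W U true)) (loc U s true).
  rewrite /= !gr.
  have V01 : opI (W U false) (W U true) `<=` opI U C01 by move=> x [[? ?] [? ?]].
  have V0 : opI (W U false) (W U true) `<=` C0 by move=> x [[? ?] [? ?]].
  have V1 : opI (W U false) (W U true) `<=` C1 by move=> x [[? ?] [? ?]].
  rewrite (res_gen0 _ _ _ V0) (res_gen1 _ _ _ V1) (gen01 _ V0 V1) gZr -gZl.
  have := congr1 (res V01) (tw_eq s).
  rewrite resZ (rres_trans _ _ _ _ V0 V1).
  rewrite (res_comp _ _ (@opIl k (W U false) (W U true))).
  by rewrite (res_comp _ _ (@opIr k (W U false) (W U true))) => <-.
have locG U s i j : res (@opIl k (W U i) (W U j)) (loc U s i) =
                    res (@opIr k (W U i) (W U j)) (loc U s j).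
  case: i; case: j.
  - by congr (res _ _); exact: Prop_irrelevance.
  - have sw : opI (W U true) (W U false) `<=` opI (W U false) (W U true).
      by move=> x [].
    have := congr1 (res sw) (loc01 U s).
    rewrite (res_comp _ _ (@opIr k (W U true) (W U false))).
    by rewrite (res_comp _ _ (@opIl k (W U true) (W U false))).
  - exact: loc01.
  - by congr (res _ _); exact: Prop_irrelevance.
have ex U (s : sec (twist n F) U) :
    exists t, forall i, res (@opIl k U (C i)) t = loc U s i.
  exact: (sec_glue (fun i => @opIl k U (C i)) (@cW U) (locG U s)).
pose phi U s := projT1 (cid (ex U s)).
have phiE U s i : res (@opIl k U (C i)) (phi U s) = loc U s i.
  exact: (projT2 (cid (ex U s))).
have ext U (s t : sec H U) :
    (forall i, res (@opIl k U (C i)) s = res (@opIl k U (C i)) t) -> s = t.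
  exact: (@sec_ext k H U bool (W U) (fun i => @opIl k U (C i)) (@cW U)).
exists phi; split.
- move=> U _; split=> [s t|f s|V VU s]; apply: ext => i.
  + by rewrite resD !phiE; case: i; rewrite /= -gDl.
  + by rewrite resZ !phiE; case: i; rewrite /= -gZl.
  + rewrite phiE (res_comp _ _ (subset_trans (@opIl k V (C i)) VU)).
    rewrite -(res_comp (@opIl k U (C i)) (opI_sub VU (C:=C i))) phiE.
    by case: i; rewrite /= gr ?(res_gen0 _ _ _ (@opIr k V C0)) ?(res_gen1 _ _ _ (@opIr k V C1)).
- move=> U s t; apply: ext => i; rewrite phiE gr.
  by case: i; rewrite /= [g _ _ _]gZl -gZr -?O_gen0 -?O_gen1.
- move=> psi psiH psiE U s; apply: ext => i.
  by rewrite phiE (locE psi psiH psiE).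
Qed.

End TwistTensorUniv.
End Tensor.

Section Cohomology.
Variable k : closedFieldType.
Implicit Types F : omodule k.

Section CechComplex.
Variables (F : omodule k) (I : Type) (U : I -> opens k).

Lemma cap_open q (s : 'I_q.+1 -> I) : open (\bigcap_(i in [set: 'I_q.+1]) U (s i)).
Proof.
rewrite -bigsetI_fset_set; last exact: finite_finset.
apply: big_ind => [|A B|i _]; [exact: openT | exact: openI |].
exact: oset_open.
Qed.

Definition cap q (s : 'I_q.+1 -> I) : opens k := Opens (@cap_open q s).

(* Cochains on all (q+1)-tuples of indices, with neither the alternating nor *)
(* the ordered normalisation.                                                *)
Definition cochain (q : nat) : Type := forall s : 'I_q.+1 -> I, sec F (cap s).

Definition face q (s : 'I_q.+2 -> I) (j : 'I_q.+2) : 'I_q.+1 -> I :=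
  fun i => s (lift j i).

Lemma cap_face q (s : 'I_q.+2 -> I) j : cap s `<=` cap (face s j).
Proof. by move=> x sx i _; apply: sx. Qed.

Definition cech_d q (c : cochain q) : cochain q.+1 := fun s =>
  \sum_(j < q.+2) (-1) ^+ j *: res (@cap_face q s j) (c (face s j)).

Definition cocycle q (c : cochain q) : Prop := forall s, cech_d c s = 0.

Definition coboundary (q : nat) : cochain q -> Prop :=
  match q with
  | 0 => fun c => forall s, c s = 0
  | q'.+1 => fun c => exists b : cochain q', forall s, c s = cech_d b s
  end.

Definition lincomb q n (a : 'I_n -> k) (c : 'I_n -> cochain q) : cochain q :=
  fun s => \sum_(i < n) const (cap s) (a i) *: c i s.

End CechComplex.

Section Refinement.
Variables (F : omodule k) (I J : Type) (U : I -> opens k) (V : J -> opens k).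
Variables (t : J -> I) (Vt : forall j, V j `<=` U (t j)).

Lemma cap_refine q (s : 'I_q.+1 -> J) : cap V s `<=` cap U (t \o s).
Proof. by move=> x sx i _; apply: Vt; apply: sx. Qed.

Definition refine_cochain q (c : cochain F U q) : cochain F V q :=
  fun s => res (@cap_refine q s) (c (t \o s)).

End Refinement.

(* H^q is Cech cohomology: the colimit, over all open covers ordered by       *)
(* refinement, of the cohomology of the Cech complexes. For coherent sheaves  *)
(* on P^1 it is the derived functor cohomology. Two cocycles, possibly for    *)
(* different covers, have the same class when they become cohomologous on a   *)
(* common refinement.                                                         *)
Definition cohomologous F q (I J : Type) (U : I -> opens k) (V : J -> opens k)
    (c : cochain F U q) (d : cochain F V q) : Prop :=
  exists (L : Type) (W : L -> opens k),
    covers W (opT k) /\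
    exists (t : L -> I) (Wt : forall l, W l `<=` U (t l))
           (u : L -> J) (Wu : forall l, W l `<=` V (u l)),
      coboundary (fun s => refine_cochain Wt c s - refine_cochain Wu d s).

(* dim_k H^q(P^1, F) = n : some n classes form a basis of H^q. *)
Definition nat_cohomology_dim F (q n : nat) : Prop :=
  exists (I : Type) (U : I -> opens k) (c : 'I_n -> cochain F U q),
    [/\ covers U (opT k),
        forall i, cocycle (c i),
        forall a : 'I_n -> k,
          cohomologous (lincomb a c) (fun s => 0 : sec F (cap U s)) ->
          forall i, a i = 0 &
        forall (J : Type) (V : J -> opens k) (z : cochain F V q),
          covers V (opT k) -> cocycle z ->
          exists a : 'I_n -> k, cohomologous z (lincomb a c)].

Definition cohomology_dim F (q : int) (n : nat) : Prop :=
  match q with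
  | Posz p => nat_cohomology_dim F p n
  | Negz _ => n = 0%N
  end.

Definition vector_bundle (r : nat) F : Prop :=
  forall x : P1 k, exists2 U : opens k, oset U x &
    iso_on U F (dsum r (structure_sheaf k)).

Definition ulrich (d : int) F : Prop :=
  forall q : int, cohomology_dim (twist (- d) F) q 0.

End Cohomology.

(* Main.v *)
From mathcomp Require Import all_boot all_order all_algebra.
From mathcomp Require Import -(notations) mpoly.
From mathcomp Require Import all_classical topology.
From mathcomp Require Import ring.
Require Import Defs.

Set Implicit Arguments.
Unset Strict Implicit.
Unset Printing Implicit Defensive.

Import GRing.Theory.
Local Open Scope classical_set_scope.
Local Open Scope quotient_scope.
Local Open Scope ring_scope.

(** Put [G = E(-d)], a bundle of the same rank; the claim is that [G] has no cohomology if
    and only if it is isomorphic to [O(-1)^r], since [E] is recovered as [G(1)(d - 1)].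

    Suppose that [G] has no cohomology. For a point [p], multiplication by the linear form
    vanishing at [p] maps [G] to [G(1)] with cokernel the fibre of [G(1)] at [p]. Vanishing
    of [H^0(G)] makes the evaluation of global sections of [G(1)] at [p] injective
    ([fibre_inj]), and vanishing of [H^1(G)] makes it surjective ([global_lift]). Hence a
    basis of the global sections of [G(1)] is a basis of every fibre, and [G(1)]
    is trivial ([twist1_trivial]). Surjectivity is used at one point only, and injectivity
    at all of them.

    Conversely the cohomology of [O(-1)^r] vanishes. As open sets are cofinite, every cover
    is refined by one whose members are [W] and one further point, for a fixed open [W].
    All intersections of different members are [W], so that Cech cochains become functions
    on tuples of points with values in the sections over [W], subject to an extension
    condition on constant tuples. The complex of all functions is contractible by a cone,
    and the extension condition can be met for free in degree at least two, while in degree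
    one it is Cousin's problem of prescribing singular parts ([acyclic]). For [O(-1)]
    this problem is solved by splitting off the polar part at a point of a quotient of
    forms ([polar_part]); the degrees -1 leave room for exactly the powers that occur. That
    there are no global sections is the same degree count ([locquot1_global]). *)

(** * Binary forms *)

Section Forms.
Variable k : closedFieldType.
Implicit Types (x y : P1 k) (phi psi : P1 k -> k).

(** A form is used only through its values at the points. Forms of equal degree then form
    a plain predicate on functions, and sums such as [m + n] of degrees need no casts. *)
Definition isform n phi := exists f : dhomog 2 k n, forall x, form_eval f x = phi x.

Lemma isform_ext n phi psi : isform n phi -> phi =1 psi -> isform n psi.
Proof. by move=> [f fE] e; exists f => x; rewrite fE. Qed.

Lemma isformD n phi psi :
  isform n phi -> isform n psi -> isform n (fun x => phi x + psi x).
Proof. by move=> [f fE] [g gE]; exists (f + g) => x; rewrite form_addE fE gE. Qed.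

Lemma isformM m n phi psi :
  isform m phi -> isform n psi -> isform (m + n) (fun x => phi x * psi x).
Proof. by move=> [f fE] [g gE]; exists (form_mul f g) => x; rewrite form_mulE fE gE. Qed.

Lemma isformZ n c phi : isform n phi -> isform n (fun x => c * phi x).
Proof. by move=> [f fE]; exists (c *: f) => x; rewrite /form_eval mevalZ -fE. Qed.

Lemma isformB n phi psi :
  isform n phi -> isform n psi -> isform n (fun x => phi x - psi x).
Proof.
move=> Hphi Hpsi; apply: isform_ext (isformD Hphi (isformZ (-1) Hpsi)) _ => x.
by rewrite mulN1r.
Qed.

Lemma isform_coord i : isform 1 (fun x => coord x i).
Proof. by exists (form_X k i) => x; exact: form_XE. Qed.

Lemma isform_const c : isform 0 (fun=> c).
Proof.
apply: isform_ext (isformZ c (ex_intro _ (form_one k) (fun=> erefl))) _ => x.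
by rewrite form_oneE mulr1.
Qed.

Lemma isform0 n : isform n (fun=> 0).
Proof. by exists 0 => x; rewrite /form_eval meval0. Qed.

Lemma isformX n m phi : isform n phi -> isform (m * n) (fun x => phi x ^+ m).
Proof.
move=> H; elim: m => [|m IH]; first by rewrite mul0n; exact: isform_const.
by rewrite mulSn; apply: isform_ext (isformM H IH) _ => x; rewrite exprS.
Qed.

Lemma isform0_const phi : isform 0 phi -> exists c, phi =1 fun=> c.
Proof.
move=> [f fE]; exists (\sum_(m <- msupp f) mcoeff m f) => x; rewrite -fE.
have /dhomogP H := valP f.
rewrite /form_eval mevalE big_seq [RHS]big_seq; apply: eq_bigr => m mf.
have /eqP := H m mf; rewrite mdeg_eq0 => /eqP ->.
by rewrite big1 ?mulr1 // => i _; rewrite mnm0E expr0.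
Qed.

(** A monomial of positive degree has a coordinate as a factor. Later inductions on the
    degree of a form start from this decomposition. *)
Lemma isform_split n phi : isform n.+1 phi -> exists psi : 'I_2 -> P1 k -> k,
  (forall i, isform n (psi i)) /\ forall x, phi x = \sum_(i < 2) coord x i * psi i x.
Proof.
move=> [f fE]; have /dhomogP H := valP f.
pose P phi := exists psi : 'I_2 -> P1 k -> k,
  (forall i, isform n (psi i)) /\ forall x, phi x = \sum_(i < 2) coord x i * psi i x.
suff : P (fun x => \sum_(m <- msupp f) mcoeff m f * \prod_(i < 2) coord x i ^+ m i).
  by move=> [psi [h1 h2]]; exists psi; split=> // x; rewrite -h2 -fE /form_eval mevalE.
have : forall m, m \in msupp f -> mdeg m = n.+1 by exact: H.
elim: (msupp f) => [|m s IH] Hs.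
  exists (fun _ _ => 0); split=> [i|x]; first exact: isform0.
  by rewrite big_nil big1 // => i _; rewrite mulr0.
have [|psi [psi1 psi2]] := IH; first by move=> m' ms; apply: Hs; rewrite inE ms orbT.
have dm : mdeg m = n.+1 by apply: Hs; rewrite inE eqxx.
have [i mi] : exists i, m i != 0%N.
  apply/existsP; apply: contraPT dm => /existsPn h.
  by rewrite mdegE big1 // => i _; apply/eqP/negPn/h.
pose m' := mnm_sub m (mnm1 i).
have mE : m = mnm_add m' (mnm1 i) by rewrite submK // lep1mP.
have dm' : mdeg m' = n by apply/eq_add_S; rewrite -dm mE mdegD mdeg1 addn1.
pose t x := mcoeff m f * \prod_(j < 2) coord x j ^+ m' j.
have tf : isform n t.
  have h : mpolyX k m' \is ishomog1 n mdeg by rewrite dhomogX; apply/eqP.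
  exists (mcoeff m f *: DHomog h) => x.
  by rewrite /form_eval mevalZ /= mevalX.
exists (fun j x => psi j x + (if j == i then t x else 0)); split.
  move=> j; case: (j == i); first exact: isformD.
  by apply: isformD => //; exact: isform0.
move=> x; rewrite big_cons psi2 [RHS](eq_bigr (fun j => coord x j * psi j x
   + (if j == i then coord x j * t x else 0))); last first.
  by move=> j _; rewrite mulrDr; case: ifP; rewrite ?mulr0.
rewrite big_split /= addrC; congr (_ + _).
rewrite -big_mkcond big_pred1_eq /t mulrCA; congr (_ * _).
rewrite (bigD1 i) //= [in RHS](bigD1 i) //= mulrA; congr (_ * _).
  by rewrite mE mnmDE mnm1E eqxx addn1 exprS.
by apply: eq_bigr => j ji; rewrite mE mnmDE mnm1E eq_sym (negbTE ji) addn0.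
Qed.

End Forms.

Lemma ord2P (i : 'I_2) : i = ord0 \/ i = ord_max.
Proof. by case: i => -[|[|//]] ?; [left|right]; apply/val_inj. Qed.

Lemma sum2E (M : nmodType) (F : 'I_2 -> M) : \sum_(i < 2) F i = F ord0 + F ord_max.
Proof.
by rewrite !big_ord_recl big_ord0 addr0; congr (_ + F _); apply/val_inj.
Qed.

Section Points.
Variable k : closedFieldType.
Implicit Types (x y p : P1 k) (phi psi : P1 k -> k).

Lemma P1_eq x y c : c != 0 -> (forall i, coord y i = c * coord x i) -> x = y.
Proof.
move=> c0 e; rewrite -[x]reprK -[y]reprK; apply/eqmodP/asboolP; exists c => //.
by apply/rowP => i; rewrite mxE; exact: e.
Qed.

Lemma P1_point (v : 'I_2 -> k) i : v i != 0 ->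
  exists x c, c != 0 /\ forall j, coord x j = c * v j.
Proof.
move=> vi; have w0 : \row_j v j != 0 :> 'rV[k]_2.
  by apply: contraNneq vi => /rowP/(_ i); rewrite !mxE => ->.
pose w : vec k := exist (fun u : 'rV[k]_2 => is_true (u != 0)) _ w0; exists (\pi w).
have /eqmodP/asboolP[c c0 e] : w = repr (\pi_(P1 k) w) %[mod P1 k] by rewrite reprK.
by exists c; split=> // j; rewrite /coord e !mxE.
Qed.

(** The linear form whose only zero is [p]. *)
Definition lin p y := coord p ord0 * coord y ord_max - coord p ord_max * coord y ord0.

Lemma isform_lin p : isform 1 (lin p).
Proof.
exact: isform_ext (isformB (isformZ (coord p ord0) (isform_coord _ ord_max))
                           (isformZ (coord p ord_max) (isform_coord _ ord0))) _.
Qed.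

Lemma lin_self p : lin p p = 0.
Proof. by rewrite /lin mulrC subrr. Qed.

Lemma lin_eq0 p y : lin p y = 0 -> y = p.
Proof.
move=> /eqP; rewrite subr_eq0 => /eqP e; apply/esym.
have [i pi] := coord_neq0 p; have [j yj] := coord_neq0 y.
have yi : coord y i != 0.
  have eij : coord p i * coord y j = coord p j * coord y i.
    by case: (ord2P i) => ->; case: (ord2P j) => ->; rewrite // -e mulrC.
  by apply: contraNneq (mulf_neq0 pi yj) => h; rewrite eij h mulr0.
apply: (@P1_eq _ _ (coord y i / coord p i)) => [|l].
  by rewrite mulf_neq0 // invr_eq0.
rewrite -mulrA [_^-1 * _]mulrC mulrA; apply/(canRL (mulfK pi)).
by case: (ord2P i) => ->; case: (ord2P l) => ->; rewrite [LHS]mulrC [RHS]mulrC.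
Qed.

Lemma lin_neq0 p y : (lin p y != 0) <-> y <> p.
Proof.
split=> [/eqP h e|h]; first by apply: h; rewrite e; exact: lin_self.
by apply/eqP => /lin_eq0.
Qed.

(** Two linear forms of which only one vanishes at [p] are independent, hence a basis. *)
Lemma coord_span p i : coord p i != 0 -> exists a b : 'I_2 -> k,
  forall j y, coord y j = a j * coord y i + b j * lin p y.
Proof.
move=> pi; have [i0|i1] := ord2P i; subst i.
  exists (fun j => if j == ord0 then 1 else coord p ord_max / coord p ord0),
         (fun j => if j == ord0 then 0 else (coord p ord0)^-1) => j y.
  case: (ord2P j) => -> /=; rewrite ?mul1r ?mul0r ?addr0 // /lin.
  by field.
exists (fun j => if j == ord_max then 1 else coord p ord0 / coord p ord_max),
       (fun j => if j == ord_max then 0 else - (coord p ord_max)^-1) => j y.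
case: (ord2P j) => -> /=; rewrite ?mul1r ?mul0r ?addr0 // /lin.
by field.
Qed.

(** The expansion of a form around [p] to first order, in the basis of the linear forms
    given by [coord_span]: the products of degree at least one in [lin p] are collected in
    the second term. *)
Lemma form_taylor p i n phi : coord p i != 0 -> isform n.+1 phi ->
  exists c psi, isform n psi /\
    forall y, phi y = c * coord y i ^+ n.+1 + lin p y * psi y.
Proof.
move=> pi; have [a [b ab]] := coord_span pi.
elim: n phi => [|n IH] phi /isform_split[psi [psif psiE]].
  have [c0 c0E] := isform0_const (psif ord0).
  have [c1 c1E] := isform0_const (psif ord_max).
  exists (c0 * a ord0 + c1 * a ord_max), (fun=> c0 * b ord0 + c1 * b ord_max).
  split=> [|y]; first exact: isform_const.
  by rewrite psiE sum2E c0E c1E (ab ord0 y) (ab ord_max y); ring.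
have [c0 [h0 [h0f h0E]]] := IH _ (psif ord0).
have [c1 [h1 [h1f h1E]]] := IH _ (psif ord_max).
exists (c0 * a ord0 + c1 * a ord_max),
  (fun y => (c0 * b ord0 + c1 * b ord_max) * coord y i ^+ n.+1
            + (coord y ord0 * h0 y + coord y ord_max * h1 y)).
split=> [|y].
  apply: isformD.
    by have := isformZ _ (isformX n.+1 (isform_coord _ i)); rewrite muln1; apply.
  rewrite -add1n.
  exact: isformD (isformM (isform_coord _ _) h0f) (isformM (isform_coord _ _) h1f).
rewrite psiE sum2E h0E h1E !exprS.
set u := coord y i ^+ n.
by rewrite (ab ord0 y) (ab ord_max y); ring.
Qed.

Lemma form_div p n phi : isform n.+1 phi -> phi p = 0 ->
  exists psi, isform n psi /\ forall y, phi y = lin p y * psi y.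
Proof.
move=> phif phip; have [i pi] := coord_neq0 p.
have [c [psi [psif e]]] := form_taylor pi phif.
exists psi; split=> // y; rewrite e.
move: phip; rewrite e lin_self mul0r addr0 => /eqP.
by rewrite mulf_eq0 expf_eq0 (negbTE pi) andbF orbF => /eqP ->; rewrite mul0r add0r.
Qed.

(** Each zero splits off a linear factor, so there are at most [n] zeros. *)
Lemma form_zeros n phi x : isform n phi -> phi x != 0 ->
  finite_set [set y | phi y = 0].
Proof.
elim: n phi => [|n IH] phi phif phix.
  have [c cE] := isform0_const phif.
  rewrite (_ : mkset _ = set0); first exact: finite_set0.
  by apply/seteqP; split=> // y /=; rewrite !cE in phix * => h; rewrite h eqxx in phix.
have [[p phip]|h] := pselect (exists p, phi p = 0); last first.
  rewrite (_ : mkset _ = set0); first exact: finite_set0.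
  by apply/seteqP; split=> // y /= phiy; apply: h; exists y.
have [psi [psif e]] := form_div phif phip.
have /(IH _ psif) fin : psi x != 0.
  by apply: contraNneq phix => h; rewrite e h mulr0.
apply: (@sub_finite_set _ _ ([set p] `|` [set y | psi y = 0])).
  move=> y /= /eqP; rewrite e mulf_eq0 => /orP[/eqP/lin_eq0|/eqP]; [by left|by right].
by rewrite finite_setU.
Qed.

Lemma closed_field_infinite : infinite_set [set: k].
Proof.
move=> /finite_seqP[s sE].
pose q : {poly k} := \prod_(a <- s) ('X - a%:P) + 1.
have sq : size q != 1%N.
  have s0 : 0 \in s by have : [set: k] 0 by []; rewrite sE.
  have ss : (0 < size s)%N by case: (s) s0.
  by rewrite /q size_polyDl size_prod_XsubC ?size_poly1 ?ltnS // eqSS -lt0n.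
have /closed_rootP[a] := sq.
rewrite /root hornerD hornerC.
have : a \in s by have : [set: k] a by []; rewrite sE.
by rewrite -root_prod_XsubC => /rootP ->; rewrite add0r oner_eq0.
Qed.

Lemma P1_infinite : infinite_set [set: P1 k].
Proof.
have pt t : exists x : P1 k, coord x ord_max / coord x ord0 = t.
  have [|x [c [c0 cE]]] := @P1_point (fun i => if i == ord0 then 1 else t) ord0.
    by rewrite oner_neq0.
  by exists x; rewrite !cE /= mulr1 mulrAC divff // mul1r.
have /choice[f fE] := pt.
have inj : injective f by move=> s t e; rewrite -(fE s) e fE.
move=> fin; apply: closed_field_infinite.
rewrite -(preimage_setT f); apply: finite_preimage fin.
exact: in2W.
Qed.

(** Binary forms as univariate polynomials, which is where the field being algebraically
    closed enters: [form_has_zero] takes a root of the dehomogenised form, or the point at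
    infinity when its degree drops. *)
Lemma isform_coef n phi : isform n phi -> exists c : nat -> k,
  forall y, phi y = \sum_(i < n.+1) c i * (coord y ord0 ^+ (n - i) * coord y ord_max ^+ i).
Proof.
elim: n phi => [|n IH] phi.
  move=> /isform0_const[c cE]; exists (fun=> c) => y.
  by rewrite cE big_ord1 !expr0 !mulr1.
move=> /isform_split[psi [psif psiE]].
have [c0 c0E] := IH _ (psif ord0); have [c1 c1E] := IH _ (psif ord_max).
exists (fun i => (if (i < n.+1)%N then c0 i else 0) + (if i is i'.+1 then c1 i' else 0)) => y.
under eq_bigr do rewrite mulrDl.
rewrite psiE sum2E big_split /= c0E c1E !mulr_sumr; congr (_ + _).
  rewrite [RHS]big_ord_recr /= ltnn mul0r addr0; apply: eq_bigr => i _.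
  by rewrite /= ltn_ord subSn -1?ltnS // exprS; ring.
rewrite [RHS]big_ord_recl /= mul0r add0r; apply: eq_bigr => i _.
by rewrite /bump /= add1n subSS exprS; ring.
Qed.

Lemma form_has_zero n phi : isform n.+1 phi -> exists y, phi y = 0.
Proof.
move=> /isform_coef[c cE]; have [c0|c0] := eqVneq (c n.+1) 0.
  have [|x [d [d0 dE]]] := @P1_point (fun i => if i == ord0 then 0 else 1) ord_max.
    by rewrite oner_neq0.
  exists x; rewrite cE big1 // => i _; rewrite !dE /= mulr0 expr0n subn_eq0.
  have [/= h|h] := leqP n.+1 i; last by rewrite mul0r mulr0.
  suff -> : nat_of_ord i = n.+1 by rewrite c0 mul0r.
  by apply/eqP; rewrite eqn_leq h -ltnS ltn_ord.
have [t tE] := @solve_monicpoly k n.+1 (fun i => - c i / c n.+1) isT.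
have [|x [d [d0 dE]]] := @P1_point (fun i => if i == ord0 then 1 else t) ord0.
  by rewrite oner_neq0.
exists x; rewrite cE.
rewrite (eq_bigr (fun i : 'I_n.+2 => d ^+ n.+1 * (c i * t ^+ i))); last first.
  move=> i _; rewrite !dE /= mulr1 exprMn.
  have -> : d ^+ n.+1 = d ^+ (n.+1 - i) * d ^+ i by rewrite -exprD subnK // -ltnS.
  by ring.
rewrite -mulr_sumr big_ord_recr /= tE mulr_sumr -big_split big1 ?mulr0 //= => i _.
by field.
Qed.

End Points.

(** * Open sets are cofinite *)

Section Topology.
Variable k : closedFieldType.
Implicit Types (x y p : P1 k) (phi psi : P1 k -> k).

Lemma open_compl_finite (U : set (P1 k)) x : open U -> U x -> finite_set (~` U).
Proof.
rewrite openE_P1 => oU /oU[n [f [fx fU]]].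
apply: (@sub_finite_set _ _ [set y | form_eval f y = 0]).
  by move=> y /= nUy; apply: contrapT => /eqP h; apply: nUy; exact: fU.
by apply: form_zeros fx; exists f.
Qed.

Lemma form_avoiding (s : seq (P1 k)) :
  exists n phi, isform n phi /\ forall y, (phi y != 0) = (y \notin s).
Proof.
elim: s => [|p s [n [phi [phif phiE]]]].
  exists 0%N, (fun=> 1); split=> [|y]; first exact: isform_const.
  by rewrite oner_neq0.
exists (1 + n)%N, (fun y => lin p y * phi y); split=> [|y].
  by apply: isformM => //; exact: isform_lin.
rewrite mulf_eq0 negb_or inE negb_or phiE; congr (_ && _).
by apply/idP/idP => [/lin_neq0/eqP|/eqP/lin_neq0].
Qed.

Lemma cofinite_open (U : set (P1 k)) : finite_set (~` U) -> open U.
Proof.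
move=> /finite_seqP[s sE]; have [n [phi [[f fE] phiE]]] := form_avoiding s.
rewrite openE_P1 => x Ux.
have h y : form_eval f y != 0 <-> U y.
  rewrite fE phiE -[U y]notK; split=> [ys nUy|nUy].
    have : [set` s] y by rewrite -sE.
    by rewrite /= (negbTE ys).
  by apply/negP => ys; apply: nUy => Uy; have : (~` U) y by rewrite sE.
exists n, f; split; first exact/h.
by move=> y /h.
Qed.

(** Nonempty open sets are cofinite, so anything larger is cofinite too. *)
Lemma open_superset (U T : set (P1 k)) x : open U -> U x -> U `<=` T -> open T.
Proof.
move=> oU Ux UT; apply/cofinite_open/(@sub_finite_set _ _ (~` U)).
  by move=> y; apply: contra_not; exact: UT.
exact: open_compl_finite Ux.
Qed.

Lemma cofinite_meets (A B : set (P1 k)) :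
  finite_set (~` A) -> finite_set (~` B) -> exists x, A x /\ B x.
Proof.
move=> fA fB; apply: contrapT => h; apply: (@P1_infinite k).
apply: (@sub_finite_set _ _ (~` A `|` ~` B)); last by rewrite finite_setU.
move=> x _; have [Ax|] := pselect (A x); last by left.
by right=> Bx; apply: h; exists x.
Qed.

Lemma open_meets (U V : opens k) x y : oset U x -> oset V y ->
  exists z, oset U z /\ oset V z.
Proof.
move=> Ux Vy; apply: cofinite_meets.
  exact: open_compl_finite (oset_open U) Ux.
exact: open_compl_finite (oset_open V) Vy.
Qed.

Lemma form_vanish n phi (U : opens k) x : isform n phi -> oset U x ->
  (forall y, oset U y -> phi y = 0) -> forall y, phi y = 0.
Proof.
move=> phif Ux h y; apply: contrapT => /eqP phiy.
have [z [/h e /eqP]] : exists z, oset U z /\ phi z <> 0; last by rewrite e eqxx.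
apply: cofinite_meets; first exact: open_compl_finite (oset_open U) Ux.
apply: sub_finite_set (form_zeros phif phiy).
by move=> z /=; exact: contrapT.
Qed.

Lemma compl1_open p : open (~` [set p]).
Proof. by apply: cofinite_open; rewrite setCK. Qed.

Definition punctured p : opens k := Opens (@compl1_open p).

End Topology.

(** * Local quotients of forms *)

Section RegularFunctions.
Variable k : closedFieldType.
Implicit Types (x y p : P1 k) (phi psi : P1 k -> k) (U V W : opens k).

(** Locally a quotient of forms whose degrees differ by [e]: with [e = 0] these are the
    regular functions, with [e = 1] the sections of O(-1) read on the chosen
    representatives of the points. *)
Definition locquot (e : nat) U phi := forall x, oset U x ->
  exists V : opens k, oset V x /\ exists n P Q, [/\ isform n P, isform (n + e) Q &
    forall y, oset V y -> Q y != 0 /\ phi y = P y / Q y].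

Lemma locquot_sub e U V phi : V `<=` U -> locquot e U phi -> locquot e V phi.
Proof. by move=> VU h x /VU /h. Qed.

Lemma locquotI e U phi : (forall x, oset U x ->
  exists V : opens k, oset V x /\ exists n P Q, [/\ isform n P, isform (n + e) Q &
    forall y, oset V y -> oset U y -> Q y != 0 /\ phi y = P y / Q y]) -> locquot e U phi.
Proof.
move=> h x Ux; have [V [Vx [n [P [Q [hP hQ hV]]]]]] := h x Ux.
exists (opI V U); split=> //; exists n, P, Q; split=> // y [Vy Uy]; exact: hV.
Qed.

Definition inpt U x (Ux : oset U x) : set_type U := SigSub (mem_set Ux).

(** Total functions on the line: values of regular functions over different open sets can
    be compared without transporting points between subtypes. *)
Definition rval U (f : regfun U) x : k :=
  if pselect (oset U x) is left Ux then f (inpt Ux) else 0.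

Lemma rvalE U (f : regfun U) x (Ux : oset U x) : rval f x = f (inpt Ux).
Proof. by rewrite /rval; case: pselect => // h; congr (rfun f _); exact/val_inj. Qed.

Lemma rval_val U (f : regfun U) (y : set_type U) : rval f (val y) = f y.
Proof.
by rewrite (rvalE _ (set_mem (valP y))); congr (rfun f _); exact/val_inj.
Qed.

Lemma rval_inj U (f g : regfun U) :
  (forall x, oset U x -> rval f x = rval g x) -> f = g.
Proof.
by move=> h; apply/regfunP => y; rewrite -!rval_val; apply: h; exact/set_mem/valP.
Qed.

Lemma rval_res U V (VU : V `<=` U) (f : regfun U) x : oset V x ->
  rval (rres VU f) x = rval f x.
Proof.
move=> Vx; rewrite (rvalE _ Vx) (rvalE _ (VU _ Vx)) rresE.
by congr (rfun f _); exact/val_inj.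
Qed.

Lemma rvalD U (f g : regfun U) x : rval (f + g) x = rval f x + rval g x.
Proof. by rewrite /rval; case: pselect => //; rewrite addr0. Qed.

Lemma rvalM U (f g : regfun U) x : rval (f * g) x = rval f x * rval g x.
Proof. by rewrite /rval; case: pselect => //; rewrite mulr0. Qed.

Lemma rvalN U (f : regfun U) x : rval (- f) x = - rval f x.
Proof. by rewrite /rval; case: pselect => //; rewrite oppr0. Qed.

Lemma rval0 U x : rval (0 : regfun U) x = 0.
Proof. by rewrite /rval; case: pselect. Qed.

Lemma rval1 U x : oset U x -> rval (1 : regfun U) x = 1.
Proof. by move=> Ux; rewrite (rvalE _ Ux). Qed.

Lemma rval_const U a x : oset U x -> rval (const U a) x = a.
Proof. by move=> Ux; rewrite (rvalE _ Ux). Qed.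

Lemma rvalX U (f : regfun U) n x : oset U x -> rval (f ^+ n) x = rval f x ^+ n.
Proof.
by move=> Ux; elim: n => [|n IH]; rewrite ?rval1 // !exprS rvalM IH.
Qed.

Lemma rval_ratio U i j (Uj : U `<=` chart k j) x : oset U x ->
  rval (ratio i Uj) x = coord x i / coord x j.
Proof. by move=> Ux; rewrite (rvalE _ Ux). Qed.

Lemma rval_trans U n (U0 : U `<=` chart k ord0) (U1 : U `<=` chart k ord_max) x :
  oset U x -> rval (trans n U0 U1) x = (coord x ord_max / coord x ord0) ^ n.
Proof.
move=> Ux; case: n => n; rewrite /trans rvalX // rval_ratio //.
by rewrite /exprz -exprVn invf_div.
Qed.

Lemma rval_locquot U (f : regfun U) : locquot 0 U (rval f).
Proof.
apply: locquotI => x Ux; have /asboolP/(_ (inpt Ux)) := valP f.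
move=> [V [Vx [n [p [q h]]]]]; exists V; split=> //.
exists n, (form_eval p), (form_eval q); rewrite addn0; split; [by exists p|by exists q|].
by move=> y Vy Uy; rewrite (rvalE _ Uy); exact: (h (inpt Uy)).
Qed.

Lemma locquot_regular U phi : locquot 0 U phi ->
  (fun y : set_type U => phi (val y)) \in regular_pred U.
Proof.
move=> h; apply/asboolP => x.
have [V [Vx [n [P [Q [[p pE] hQ hV]]]]]] := h _ (set_mem (valP x)).
exists V; split=> //; exists n.
move: hQ; rewrite addn0 => -[q qE]; exists p, q => y Vy.
by rewrite pE qE; exact: hV.
Qed.

Definition mkreg U phi (h : locquot 0 U phi) : regfun U := RegFun (locquot_regular h).

Lemma rval_mkreg U phi (h : locquot 0 U phi) x : oset U x -> rval (mkreg h) x = phi x.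
Proof. by move=> Ux; rewrite (rvalE _ Ux). Qed.

Lemma locquot_quot e U n P Q : isform n P -> isform (n + e) Q ->
  (forall y, oset U y -> Q y != 0) -> locquot e U (fun y => P y / Q y).
Proof.
by move=> hP hQ h x Ux; exists U; split=> //; exists n, P, Q; split=> // y /h.
Qed.

Lemma locquot_ext e U phi psi : (forall y, oset U y -> phi y = psi y) ->
  locquot e U phi -> locquot e U psi.
Proof.
move=> E h; apply: locquotI => x /h[V [Vx [n [P [Q [hP hQ hV]]]]]].
by exists V; split=> //; exists n, P, Q; split=> // y Vy Uy; rewrite -E //; exact: hV.
Qed.

Lemma locquot_cover e U phi : (forall x, oset U x ->
  exists V : opens k, oset V x /\ locquot e V phi) -> locquot e U phi.
Proof. by move=> h x /h[V [Vx /(_ _ Vx)]]. Qed.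

Lemma locquotM e e' U phi psi : locquot e U phi -> locquot e' U psi ->
  locquot (e + e') U (fun y => phi y * psi y).
Proof.
move=> h h' x Ux; have [V [Vx [n [P [Q [hP hQ hV]]]]]] := h x Ux.
have [V' [V'x [n' [P' [Q' [hP' hQ' hV']]]]]] := h' x Ux.
exists (opI V V'); split=> //.
exists (n + n')%N, (fun y => P y * P' y), (fun y => Q y * Q' y); split.
- exact: isformM.
- by rewrite addnACA; exact: isformM.
- move=> y [/hV[Q0 ->] /hV'[Q'0 ->]]; split; first by rewrite mulf_neq0.
  by rewrite mulf_div.
Qed.

Lemma locquotD e U phi psi : locquot e U phi -> locquot e U psi ->
  locquot e U (fun y => phi y + psi y).
Proof.
move=> h h' x Ux; have [V [Vx [n [P [Q [hP hQ hV]]]]]] := h x Ux.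
have [V' [V'x [n' [P' [Q' [hP' hQ' hV']]]]]] := h' x Ux.
exists (opI V V'); split=> //.
exists (n + n' + e)%N, (fun y => P y * Q' y + P' y * Q y), (fun y => Q y * Q' y); split.
- apply: isformD.
    by rewrite -addnA; exact: isformM.
  by rewrite [(n + n')%N]addnC -addnA; exact: isformM.
- by rewrite -addnA addnACA; exact: isformM.
- move=> y [/hV[Q0 ->] /hV'[Q'0 ->]]; split; first by rewrite mulf_neq0.
  by rewrite addf_div.
Qed.

Lemma locquotN e U phi : locquot e U phi -> locquot e U (fun y => - phi y).
Proof.
move=> h x Ux; have [V [Vx [n [P [Q [hP hQ hV]]]]]] := h x Ux.
exists V; split=> //; exists n, (fun y => - 1 * P y), Q; split=> //.
  exact: isformZ.
by move=> y /hV[Q0 ->]; rewrite mulN1r mulNr.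
Qed.

Lemma locquot0 e U : locquot e U (fun=> 0).
Proof.
move=> x Ux; have [i xi] := coord_neq0 x.
exists (chart k i); split; first exact/chartP.
exists 0%N, (fun=> 0), (fun y => coord y i ^+ e); split; first exact: isform0.
  by have := isformX e (isform_coord k i); rewrite muln1 add0n.
by move=> y /chartP yi; rewrite mul0r expf_neq0.
Qed.

(** Near any point the numerator is a form that vanishes on a nonempty open set, hence at
    infinitely many points. *)
Lemma locquot_vanish e U V phi z : locquot e U phi -> oset V z ->
  (forall y, oset V y -> phi y = 0) -> forall x, oset U x -> phi x = 0.
Proof.
move=> h Vz V0 x Ux; have [W [Wx [n [P [Q [hP hQ hW]]]]]] := h x Ux.
have [w [Ww Vw]] := open_meets Wx Vz.
suff P0 : forall y, P y = 0 by have [_ ->] := hW _ Wx; rewrite P0 mul0r.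
apply: (form_vanish (U := opI W V) hP (conj Ww Vw)) => y [Wy Vy].
have [Q0 /esym] := hW _ Wy; rewrite V0 // => /eqP.
by rewrite mulf_eq0 invr_eq0 (negbTE Q0) orbF => /eqP.
Qed.

End RegularFunctions.

(** * Sheaves of modules: gluing and isomorphisms *)

Section OModules.
Variable k : closedFieldType.
Implicit Types (U V W : opens k) (F G H : omodule k).

Local Notation C0 := (chart k ord0).
Local Notation C1 := (chart k ord_max).
Local Notation C01 := (opI C0 C1).

Lemma res_irr F U V (h h' : V `<=` U) (s : sec F U) : res h s = res h' s.
Proof. by congr (res _ _); exact: Prop_irrelevance. Qed.

Lemma res_sum F U V (VU : V `<=` U) (I : Type) (r : seq I) (P : pred I)
    (s : I -> sec F U) :
  res VU (\sum_(i <- r | P i) s i) = \sum_(i <- r | P i) res VU (s i).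
Proof. by apply: (big_morph (res VU)); [exact: resD | exact: res0]. Qed.

Lemma subT U : U `<=` opT k. Proof. by []. Qed.

(** With restriction made total, families of sections indexed by arbitrary open sets can be
    written down without carrying proofs of inclusion. *)
Definition resd F U V (s : sec F U) : sec F V :=
  if pselect (V `<=` U) is left h then res h s else 0.

Lemma resdE F U V (h : V `<=` U) (s : sec F U) : resd V s = res h s.
Proof. by rewrite /resd; case: pselect => // h'; exact: res_irr. Qed.

Lemma res_resd F U V W (WV : W `<=` V) (VU : V `<=` U) (s : sec F U) :
  res WV (resd V s) = resd W s.
Proof.
by rewrite (resdE VU) (res_comp _ _ (subset_trans WV VU)) (resdE (subset_trans WV VU)).
Qed.

Lemma cover2 U V1 V2 : (forall x, oset U x -> oset V1 x \/ oset V2 x) ->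
  covers (fun i : bool => if i then V1 else V2) U.
Proof. by move=> h x /h[]; [exists true|exists false]. Qed.

Section Two.
Variables (F : omodule k) (U V1 V2 : opens k) (V1U : V1 `<=` U) (V2U : V2 `<=` U).
Hypothesis cov : forall x, oset U x -> oset V1 x \/ oset V2 x.

Lemma ext2 (s t : sec F U) :
  res V1U s = res V1U t -> res V2U s = res V2U t -> s = t.
Proof.
move=> e1 e2.
have WU i : (if i then V1 else V2) `<=` U by case: i.
apply: (@sec_ext _ F _ _ _ WU (cover2 cov)) => -[].
  exact: etrans (res_irr _ V1U _) (etrans e1 (res_irr _ _ _)).
exact: etrans (res_irr _ V2U _) (etrans e2 (res_irr _ _ _)).
Qed.

Lemma glue2 (s1 : sec F V1) (s2 : sec F V2) :
  res (@opIl k V1 V2) s1 = res (@opIr k V1 V2) s2 ->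
  exists t, res V1U t = s1 /\ res V2U t = s2.
Proof.
move=> e; have WU (i : bool) : (if i then V1 else V2) `<=` U by case: i.
pose s (i : bool) : sec F (if i then V1 else V2) :=
  if i is true then s1 else s2.
have [|t tE] := @sec_glue _ F _ _ _ WU (cover2 cov) s.
  case=> -[] /=; [exact: res_irr|exact: e| |exact: res_irr].
  have sw : opI V2 V1 `<=` opI V1 V2 by move=> x [].
  have := congr1 (res sw) e; rewrite (res_comp _ _ (@opIr k V2 V1)) => ->.
  exact/esym/res_comp.
exists t; split; first exact: etrans (res_irr _ _ _) (tE true).
exact: etrans (res_irr _ _ _) (tE false).
Qed.

End Two.

Lemma chart_cover U x : oset U x -> oset (opI U C0) x \/ oset (opI U C1) x.
Proof.
move=> Ux; have [i /chartP xi] := coord_neq0 x.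
by case: (ord2P i) => e; rewrite e in xi; [left|right].
Qed.

Lemma ext_charts F U (s t : sec F U) :
  res (@opIl k U C0) s = res (@opIl k U C0) t ->
  res (@opIl k U C1) s = res (@opIl k U C1) t -> s = t.
Proof. exact/ext2/chart_cover. Qed.

Lemma inj_surj_bij (A B : Type) (f : A -> B) :
  injective f -> (forall y, exists x, f x = y) -> bijective f.
Proof. by move=> fI /choice[g gE]; exists g => // x; apply: fI. Qed.

Lemma bij_surj (A B : Type) (f : A -> B) : bijective f -> forall y, exists x, f x = y.
Proof. by move=> [g _ fK] y; exists (g y). Qed.

Section Homs.
Variables (U : opens k) (F G : omodule k) (phi : forall V, sec F V -> sec G V).
Arguments phi : clear implicits.
Hypothesis phiH : hom_on U phi.

Lemma homD V s t : V `<=` U -> phi V (s + t) = phi V s + phi V t.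
Proof. by move=> /phiH[]. Qed.

Lemma homZ V (f : regfun V) s : V `<=` U -> phi V (f *: s) = f *: phi V s.
Proof. by move=> /phiH[]. Qed.

Lemma hom_res V W (WV : W `<=` V) s : V `<=` U -> phi W (res WV s) = res WV (phi V s).
Proof. by move=> /phiH[]. Qed.

Lemma hom0 V : V `<=` U -> phi V 0 = 0.
Proof. by move=> VU; apply: (addrI (phi V 0)); rewrite -homD // !addr0. Qed.

Lemma homN V s : V `<=` U -> phi V (- s) = - phi V s.
Proof. by move=> VU; apply: (addrI (phi V s)); rewrite -homD // !subrr hom0. Qed.

Lemma hom_sum V (I : Type) (r : seq I) (P : pred I) (s : I -> sec F V) : V `<=` U ->
  phi V (\sum_(i <- r | P i) s i) = \sum_(i <- r | P i) phi V (s i).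
Proof. by move=> VU; apply: big_morph => [? ?|]; rewrite ?homD ?hom0. Qed.

End Homs.

Lemma iso_on_sub U V F G : V `<=` U -> iso_on U F G -> iso_on V F G.
Proof.
move=> VU [phi h b]; exists phi => W WV; [apply: h|apply: b]; exact: subset_trans VU.
Qed.

Lemma iso_on_sym U F G : iso_on U F G -> iso_on U G F.
Proof.
move=> [phi h b].
have ex V : exists g : sec G V -> sec F V, V `<=` U ->
    cancel (phi V) g /\ cancel g (phi V).
  have [/b[g g1 g2]|VU] := pselect (V `<=` U); first by exists g.
  by exists (fun=> 0) => /VU.
pose psi V := projT1 (cid (ex V)).
have psiK V (VU : V `<=` U) : cancel (phi V) (psi V) by have [] := projT2 (cid (ex V)) VU.
have phiK V (VU : V `<=` U) : cancel (psi V) (phi V) by have [] := projT2 (cid (ex V)) VU.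
exists psi => [V VU|V VU]; last by exists (phi V); [exact: phiK|exact: psiK].
have inj := can_inj (psiK V VU).
split=> [s t|f s|W WV s]; last have WU := subset_trans WV VU.
- by apply: inj; rewrite (homD h) // !phiK.
- by apply: inj; rewrite (homZ h) // !phiK.
- by apply: (can_inj (psiK W WU)); rewrite (hom_res h) // !phiK.
Qed.

Lemma iso_on_trans U F G H : iso_on U F G -> iso_on U G H -> iso_on U F H.
Proof.
move=> [phi h b] [psi h' b']; exists (fun V => psi V \o phi V) => V VU.
  split=> [s t|f s|W WV s] /=.
  - by rewrite (homD h) // (homD h').
  - by rewrite (homZ h) // (homZ h').
  - by rewrite (hom_res h) // (hom_res h').
by apply: bij_comp; [exact: b'|exact: b].
Qed.

(** Local preimages are unique, hence glue. *)
Lemma local_iso F G (phi : forall V, sec F V -> sec G V) : hom_on (opT k) phi ->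
  (forall x, exists U, oset U x /\ forall V, V `<=` U -> bijective (phi V)) -> iso F G.
Proof.
move=> h loc; exists phi => // V _.
have /choice[N NE] := loc.
pose W x := opI V (N x).
have WV x : W x `<=` V by exact: opIl.
have bW x (D : opens k) : D `<=` W x -> bijective (phi D).
  by move=> DW; have [_] := NE x; apply=> y /DW[].
have cW : covers W V by move=> x Vx; exists x => //; split=> //; have [] := NE x.
apply: inj_surj_bij => [s t e|s].
  apply: (@sec_ext _ F _ _ _ WV cW) => x; apply: (bij_inj (bW x _ (@subset_refl _ _))).
  by rewrite !(hom_res h) // e.
have ex x : exists t, phi _ t = res (WV x) s by exact/bij_surj/(bW x).
pose t x := projT1 (cid (ex x)).
have tE x : phi _ (t x) = res (WV x) s by exact: (projT2 (cid (ex x))).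
have [x y|u uE] := @sec_glue _ F _ _ _ WV cW t.
  apply: (bij_inj (bW x _ (@opIl _ _ _))); rewrite !(hom_res h) // !tE.
  by rewrite !(res_comp _ _ (subset_trans (@opIl k (W x) (W y)) (WV x))).
exists u; apply: (@sec_ext _ G _ _ _ WV cW) => x.
by rewrite -(hom_res h) // uE tE.
Qed.

End OModules.

(** * Twists *)

Section Twists.
Variable k : closedFieldType.
Implicit Types (U V W : opens k) (F G H : omodule k).

Local Notation C0 := (chart k ord0).
Local Notation C1 := (chart k ord_max).
Local Notation C01 := (opI C0 C1).

Lemma transD m n U (U0 : U `<=` C0) (U1 : U `<=` C1) :
  trans (m + n) U0 U1 = trans m U0 U1 * trans n U0 U1.
Proof.
apply: rval_inj => x Ux; rewrite rvalM !rval_trans // expfzDr //.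
by rewrite mulf_neq0 ?invr_eq0 //; apply/chartP; [apply: U1|apply: U0].
Qed.

Lemma trans0 U (U0 : U `<=` C0) (U1 : U `<=` C1) : trans 0 U0 U1 = 1.
Proof. by []. Qed.

Lemma twmulDl n F U s s' (t : sec (O_P1 k n) U) :
  twmul (s + s' : sec F U) t = twmul s t + twmul s' t.
Proof. by have [] := twmul_bilin n F U. Qed.

Lemma twmulZl n F U f (s : sec F U) (t : sec (O_P1 k n) U) :
  twmul (f *: s) t = f *: twmul s t.
Proof. by have [_ _ /(_ f s t)[]] := twmul_bilin n F U. Qed.

Lemma twmulZr n F U f (s : sec F U) (t : sec (O_P1 k n) U) :
  twmul s (f *: t) = f *: twmul s t.
Proof. by have [_ _ /(_ f s t)[]] := twmul_bilin n F U. Qed.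

Lemma res_twmul n F U V (VU : V `<=` U) (s : sec F U) (t : sec (O_P1 k n) U) :
  res VU (twmul s t) = twmul (res VU s) (res VU t).
Proof. by have [_ _ _] := twmul_bilin n F U; apply. Qed.

Lemma twmul_tw0 n F V (V0 : V `<=` C0) (VI : V `<=` opI V C0) (s : sec (twist n F) V) :
  twmul (res VI (tw0 s)) (gen0 n V0) = s.
Proof.
rewrite -(res_gen0 n VI (@opIr k V C0)) -res_twmul -tw_gen0.
by rewrite (res_comp _ _ (@subset_refl _ _)) res_id.
Qed.

Lemma tw0_twmul n F V (V0 : V `<=` C0) (VI : V `<=` opI V C0) (s : sec F V) :
  res VI (tw0 (twmul s (gen0 n V0))) = s.
Proof. by rewrite /tw0 /tw1 /= scale1r (res_comp _ _ (@subset_refl _ _)) res_id. Qed.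

Lemma subI0 V : V `<=` C0 -> V `<=` opI V C0.
Proof. by move=> V0 x Vx; split=> //; exact: V0. Qed.

Lemma twmul_tw1 n F V (V1 : V `<=` C1) (VI : V `<=` opI V C1) (s : sec (twist n F) V) :
  twmul (res VI (tw1 s)) (gen1 n V1) = s.
Proof.
rewrite -(res_gen1 n VI (@opIr k V C1)) -res_twmul -tw_gen1.
by rewrite (res_comp _ _ (@subset_refl _ _)) res_id.
Qed.

Lemma tw1_twmul n F V (V1 : V `<=` C1) (VI : V `<=` opI V C1) (s : sec F V) :
  res VI (tw1 (twmul s (gen1 n V1))) = s.
Proof. by rewrite /tw0 /tw1 /= scale1r (res_comp _ _ (@subset_refl _ _)) res_id. Qed.

Lemma subI1 V : V `<=` C1 -> V `<=` opI V C1.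
Proof. by move=> V1 x Vx; split=> //; exact: V1. Qed.

(** Over a chart, a section of the twist is determined by its component there, because the
    power of the coordinate generates the twisting sheaf. *)
Lemma twist_chart0 n F : iso_on C0 (twist n F) F.
Proof.
exists (fun V s => resd V (tw0 s)) => V V0;
  have VI := subI0 V0.
  split=> [s t|f s|W WV s].
  - by rewrite !(resdE VI) /= resD.
  - rewrite !(resdE VI) /= resZ; congr (_ *: _).
    by rewrite (rres_comp _ _ (@subset_refl _ _)) rres_id.
  - have WI : W `<=` opI W C0 by move=> x Wx; split=> //; exact/V0/WV.
    rewrite (resdE VI) (resdE WI) /= (res_comp _ _ (subset_trans WV VI)).
    by rewrite (res_comp _ _ (subset_trans WV VI)).
exists (fun s : sec F V => twmul s (gen0 n V0)) => s.
  by rewrite (resdE VI) twmul_tw0.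
by rewrite (resdE VI) tw0_twmul.
Qed.

Lemma twist_chart1 n F : iso_on C1 (twist n F) F.
Proof.
exists (fun V s => resd V (tw1 s)) => V V1;
  have VI := subI1 V1.
  split=> [s t|f s|W WV s].
  - by rewrite !(resdE VI) /= resD.
  - rewrite !(resdE VI) /= resZ; congr (_ *: _).
    by rewrite (rres_comp _ _ (@subset_refl _ _)) rres_id.
  - have WI : W `<=` opI W C1 by move=> x Wx; split=> //; exact/V1/WV.
    rewrite (resdE VI) (resdE WI) /= (res_comp _ _ (subset_trans WV VI)).
    by rewrite (res_comp _ _ (subset_trans WV VI)).
exists (fun s : sec F V => twmul s (gen1 n V1)) => s.
  by rewrite (resdE VI) twmul_tw1.
by rewrite (resdE VI) tw1_twmul.
Qed.

Lemma vector_bundle_twist r n F : vector_bundle r F -> vector_bundle r (twist n F).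
Proof.
move=> h x; have [U Ux FU] := h x.
have [i /chartP xi] := coord_neq0 x; exists (opI U (chart k i)) => //.
refine (iso_on_trans _ (iso_on_sub (@opIl _ _ _) FU)).
refine (iso_on_sub (@opIr _ _ _) _).
by case: (ord2P i) => ->; [exact: twist_chart0|exact: twist_chart1].
Qed.

Lemma twist_iso n F G : iso F G -> iso (twist n F) (twist n G).
Proof.
move=> [phi h b].
have P U (s : sec (twist n F) U) : (phi _ (tw0 s), phi _ (tw1 s)) \in @tw_pred k n G U.
  by apply/asboolP; rewrite /= -!(hom_res h) // tw_eq (homZ h).
exists (fun U s => TwSec (P U s)) => U _.
  by split=> [s t|f s|V VU s]; apply: twP; rewrite /= ?(homD h) ?(homZ h) ?(hom_res h).
apply: inj_surj_bij => [s t e|s].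
  apply: twP; apply: (bij_inj (b _ (@subT _ _))).
    exact: (congr1 (fun u => (tws u).1) e).
  exact: (congr1 (fun u => (tws u).2) e).
have [a aE] := bij_surj (b (opI U C0) (@subT _ _)) (tw0 s).
have [c cE] := bij_surj (b (opI U C1) (@subT _ _)) (tw1 s).
have ac : (a, c) \in @tw_pred k n F U.
  apply/asboolP => /=; apply: (bij_inj (b (opI U C01) (@subT _ _))).
  by rewrite (homZ h) // !(hom_res h) // aE cE; exact: tw_eq.
by exists (TwSec ac); apply: twP; rewrite /= ?aE ?cE.
Qed.

Lemma dsum_iso r F G : iso F G -> iso (dsum r F) (dsum r G).
Proof.
move=> [phi h b].
exists (fun U (s : sec (dsum r F) U) => [ffun a => phi _ (s a)] : sec (dsum r G) U) => U _.
  by split=> [s t|f s|V VU s]; apply/ffunP => a;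
    rewrite !ffunE ?(homD h) ?(homZ h) ?(hom_res h).
apply: inj_surj_bij => [s t /ffunP e|s].
  by apply/ffunP => a; apply: (bij_inj (b U (@subT _ _))); have := e a; rewrite !ffunE.
have /choice[t tE] a : exists t, phi _ t = s a by exact/bij_surj/b.
by exists [ffun a => t a]; apply/ffunP => a; rewrite !ffunE tE.
Qed.

Lemma twist_dsum r n F : iso (twist n (dsum r F)) (dsum r (twist n F)).
Proof.
have P U (s : sec (twist n (dsum r F)) U) (a : 'I_r) :
    (tw0 s a, tw1 s a) \in @tw_pred k n F U.
  by apply/asboolP; have /ffunP/(_ a) := tw_eq s; rewrite !ffunE.
exists (fun U s => [ffun a => TwSec (P U s a)] : sec (dsum r (twist n F)) U) => U _.
  by split=> [s t|f s|V VU s]; apply/ffunP => a; rewrite !ffunE; apply: twP;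
    rewrite /= !ffunE.
apply: inj_surj_bij => [s t /ffunP e|s].
  apply: twP; apply/ffunP => a; have := e a; rewrite !ffunE.
    by move=> /(congr1 (fun u => (tws u).1)).
  by move=> /(congr1 (fun u => (tws u).2)).
have st : ([ffun a => tw0 (s a)] : sec (dsum r F) _, [ffun a => tw1 (s a)] : sec (dsum r F) _)
    \in @tw_pred k n (dsum r F) U.
  by apply/asboolP; apply/ffunP => a; rewrite /= !ffunE; exact: tw_eq.
by exists (TwSec st); apply/ffunP => a; rewrite !ffunE; apply: twP; rewrite /= ffunE.
Qed.

Lemma twist0_iso F : iso F (twist 0 F).
Proof.
have P U (s : sec F U) : (res (@opIl k U C0) s, res (@opIl k U C1) s) \in @tw_pred k 0 F U.
  by apply/asboolP; rewrite trans0 scale1r /= !(res_comp _ _ (@opIl k U C01)).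
exists (fun U s => TwSec (P U s)) => U _.
  split=> [s t|f s|V VU s]; apply: twP; rewrite /= ?resD ?resZ //.
    rewrite (res_comp _ _ (subset_trans (@opIl k V C0) VU)).
    by rewrite (res_comp _ _ (subset_trans (@opIl k V C0) VU)).
  rewrite (res_comp _ _ (subset_trans (@opIl k V C1) VU)).
  by rewrite (res_comp _ _ (subset_trans (@opIl k V C1) VU)).
apply: inj_surj_bij => [s t e|s].
  apply: ext_charts; first exact: (congr1 (fun u => (tws u).1) e).
  exact: (congr1 (fun u => (tws u).2) e).
have [|t [t0 t1]] := glue2 (@opIl k U C0) (@opIl k U C1) (@chart_cover k U)
  (s1 := tw0 s) (s2 := tw1 s).
  have h : opI (opI U C0) (opI U C1) `<=` opI U C01 by move=> x [[? ?] []].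
  have := congr1 (res h) (tw_eq s); rewrite trans0 scale1r.
  rewrite (res_comp _ _ (@opIl k (opI U C0) (opI U C1))).
  by rewrite (res_comp _ _ (@opIr k (opI U C0) (opI U C1))).
by exists t; apply: twP.
Qed.

(** A section of the iterated twist over a chart is a section of the inner twist, that is
    a multiple of the generator of O(n) there; the transition functions of the two charts
    multiply. *)
Lemma twist_twist m n F : iso (twist (m + n) F) (twist m (twist n F)).
Proof.
have P U (s : sec (twist (m + n) F) U) :
    (twmul (tw0 s) (gen0 n (@opIr k U C0)), twmul (tw1 s) (gen1 n (@opIr k U C1)))
      \in @tw_pred k m (twist n F) U.
  apply/asboolP; rewrite [LHS]res_twmul [in RHS]res_twmul.
  rewrite (res_gen0 n _ _ (@sub0 k U)) (res_gen1 n _ _ (@sub1 k U)).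
  rewrite (gen01 n (@sub0 k U) (@sub1 k U)) twmulZr scalerA -transD -twmulZl.
  by congr (twmul _ _); exact: tw_eq.
exists (fun U s => TwSec (P U s)) => U _.
  split=> [s t|f s|V VU s]; apply: twP; rewrite /= ?twmulDl ?twmulZl //.
    by rewrite [RHS]res_twmul (res_gen0 n _ _ (@opIr k V C0)).
  by rewrite [RHS]res_twmul (res_gen1 n _ _ (@opIr k V C1)).
have gI0 V (V0 : V `<=` C0) (s t : sec F V) :
    twmul s (gen0 n V0) = twmul t (gen0 n V0) -> s = t.
  by move=> /(congr1 (fun u => res (subI0 V0) (tw0 u))); rewrite !tw0_twmul.
have gI1 V (V1 : V `<=` C1) (s t : sec F V) :
    twmul s (gen1 n V1) = twmul t (gen1 n V1) -> s = t.
  by move=> /(congr1 (fun u => res (subI1 V1) (tw1 u))); rewrite !tw1_twmul.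
apply: inj_surj_bij => [s t e|s].
  apply: twP; first exact: gI0 (congr1 (fun u => (tws u).1) e).
  exact: gI1 (congr1 (fun u => (tws u).2) e).
have aE := twmul_tw0 (@opIr k U C0) (subI0 (@opIr k U C0)) (tw0 s).
set a := res _ _ in aE.
have bE := twmul_tw1 (@opIr k U C1) (subI1 (@opIr k U C1)) (tw1 s).
set b := res _ _ in bE.
have ab : (a, b) \in @tw_pred k (m + n) F U.
  apply/asboolP => /=; apply: (gI0 _ (@sub0 k U)).
  rewrite twmulZl transD -scalerA -twmulZl -[_ *: twmul _ _]twmulZr.
  have := tw_eq s; rewrite -/(tw0 s) -/(tw1 s) -aE -bE !res_twmul.
  rewrite (res_gen0 n _ _ (@sub0 k U)) (res_gen1 n _ _ (@sub1 k U)).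
  rewrite (gen01 n (@sub0 k U) (@sub1 k U)) => ->.
  by rewrite !twmulZr twmulZl.
by exists (TwSec ab); apply: twP.
Qed.

End Twists.

(** * Cech cochains *)

Section Simplices.
Variables (X : Type) (R : pzRingType) (M : lmodType R).

(** The cochain complex of the full simplex on [X]; a cochain of degree [n - 1] is a
    function on [n]-tuples, so that the augmentation is the case [n = 0]. *)
Definition sdiff n (c : ('I_n -> X) -> M) (s : 'I_n.+1 -> X) : M :=
  \sum_(j < n.+1) (-1) ^+ j *: c (fun i => s (lift j i)).

Definition scons n (x : X) (s : 'I_n -> X) (i : 'I_n.+1) : X :=
  if unlift ord0 i is Some j then s j else x.

Lemma scons0 n x (s : 'I_n -> X) : scons x s ord0 = x.
Proof. by rewrite /scons unlift_none. Qed.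

Lemma sconsS n x (s : 'I_n -> X) i : scons x s (lift ord0 i) = s i.
Proof. by rewrite /scons liftK. Qed.

Lemma scons_eta n (s : 'I_n.+1 -> X) : s = scons (s ord0) (fun i => s (lift ord0 i)).
Proof. by apply/funext => i; case: (unliftP ord0 i) => [j|] ->; rewrite ?scons0 ?sconsS. Qed.

Lemma scons_const n (x : X) : scons x (fun _ : 'I_n => x) = fun=> x.
Proof. by rewrite [RHS]scons_eta. Qed.

Lemma scons_lift n x (s : 'I_n.+1 -> X) (j : 'I_n.+1) :
  (fun i => scons x s (lift (lift ord0 j) i)) = scons x (fun i => s (lift j i)).
Proof.
apply/funext => i; case: (unliftP ord0 i) => [l|] ->.
  rewrite sconsS -[in RHS](sconsS x s); congr (scons x s _).
  by apply/val_inj; rewrite /= !/bump /= !add1n ltnS addnS.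
rewrite scons0 -[RHS](scons0 x s); congr (scons x s _).
exact/val_inj.
Qed.

(** Coning with [x] is a contracting homotopy. *)
Lemma sdiff_scons n (c : ('I_n.+1 -> X) -> M) x s :
  sdiff c (scons x s) = c s - sdiff (fun t => c (scons x t)) s.
Proof.
rewrite {1}/sdiff big_ord_recl /= expr0 scale1r; congr (_ + _).
  by congr (c _); apply/funext => i; exact: sconsS.
rewrite -sumrN; apply: eq_bigr => j _; rewrite scons_lift.
by rewrite /bump /= add1n exprS mulN1r scaleNr.
Qed.

Lemma eq_sdiff n (c c' : ('I_n -> X) -> M) : c =1 c' -> sdiff c =1 sdiff c'.
Proof. by move=> e s; apply: eq_bigr => j _; rewrite e. Qed.

Lemma sdiffB n (c c' : ('I_n -> X) -> M) s :
  sdiff (fun t => c t - c' t) s = sdiff c s - sdiff c' s.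
Proof. by rewrite -sumrB; apply: eq_bigr => j _; rewrite scalerBr. Qed.

(** The square of the differential vanishes by induction along the cone: replacing a
    cochain by its contraction lowers the degree. *)
Lemma sdiffK n (c : ('I_n -> X) -> M) s : sdiff (sdiff c) s = 0.
Proof.
elim: n c s => [|n IH] c s; rewrite [s]scons_eta sdiff_scons.
  rewrite /sdiff !big_ord1 !expr0 !scale1r.
  by apply/eqP; rewrite subr_eq0; apply/eqP; congr (c _); apply/funext => -[].
set x := s ord0; set s' := fun i => _.
have e : (fun t => sdiff c (scons x t)) =1
    fun t => c t - sdiff (fun t' => c (scons x t')) t.
  by move=> t; exact: sdiff_scons.
by rewrite (eq_sdiff e) sdiffB IH subr0 subrr.
Qed.

Lemma alt_sum n (v : M) : \sum_(j < n) (-1) ^+ j *: v = if odd n then v else 0.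
Proof.
elim: n => [|n IH]; first by rewrite big_ord0.
rewrite big_ord_recr /= IH -signr_odd; case: (odd n); rewrite /= ?expr1 ?expr0.
  by rewrite scaleN1r subrr.
by rewrite scale1r add0r.
Qed.

Lemma sdiff_const n (c : ('I_n -> X) -> M) x :
  sdiff c (fun=> x) = if odd n.+1 then c (fun=> x) else 0.
Proof. by rewrite -alt_sum. Qed.

End Simplices.

Section CechTheory.
Variable k : closedFieldType.
Implicit Types (U V W : opens k) (G : omodule k).

Lemma coboundary_ext G (I : Type) (U : I -> opens k) q (c c' : cochain G U q) :
  (forall s, c s = c' s) -> coboundary c -> coboundary c'.
Proof.
case: q c c' => [|q] c c' e /= => [h s|[b bE]]; first by rewrite -e.
by exists b => s; rewrite -e.
Qed.

(** With no classes in the basis, the second cover in the definition of the dimension can be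
    taken to be the whole line. *)
Lemma cohomology0P G q : nat_cohomology_dim G q 0 <->
  forall (J : Type) (V : J -> opens k) (z : cochain G V q),
    covers V (opT k) -> cocycle z ->
    exists (L : Type) (W : L -> opens k) (t : L -> J) (Wt : forall l, W l `<=` V (t l)),
      covers W (opT k) /\ coboundary (refine_cochain Wt z).
Proof.
have zero (I : Type) (U : I -> opens k) (c : 'I_0 -> cochain G U q) a s :
    lincomb a c s = 0 by rewrite /lincomb big_ord0.
split=> [[I [U [c [_ _ _ H]]]] J V z Vc zc|H].
  have [a [L [W [Wc [t [Wt [u [Wu cb]]]]]]]] := H J V z Vc zc.
  exists L, W, t, Wt; split=> //; apply: coboundary_ext cb => s.
  by rewrite /refine_cochain zero res0 subr0.
exists unit, (fun=> opT k), (fun=> fun=> 0); split.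
- by move=> x _; exists tt.
- by case.
- by move=> a _ [].
move=> J V z Vc /(H J V z Vc)[L [W [t [Wt [Wc cb]]]]].
exists (fun=> 0), L, W; split=> //.
exists t, Wt, (fun=> tt), (fun l => @subT k (W l)).
apply: coboundary_ext cb => s.
by rewrite [X in _ - X]/refine_cochain zero res0 subr0.
Qed.

Lemma rres_sign U V (VU : V `<=` U) n : rres VU ((-1) ^+ n) = (-1) ^+ n.
Proof. by rewrite rresX; congr (_ ^+ _); exact/regfunP. Qed.

Lemma cech_d_refine G (I J : Type) (U : I -> opens k) (V : J -> opens k) (t : J -> I)
    (Vt : forall j, V j `<=` U (t j)) q (c : cochain G U q) s :
  cech_d (refine_cochain Vt c) s = refine_cochain Vt (cech_d c) s.
Proof.
rewrite /refine_cochain res_sum; apply: eq_bigr => j _.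
rewrite resZ rres_sign; congr (_ *: _).
have h : cap V s `<=` cap U (face (t \o s) j) by move=> x sx i _; exact/Vt/sx.
by rewrite (res_comp _ _ h) (res_comp _ _ h).
Qed.

Lemma cocycle_refine G (I J : Type) (U : I -> opens k) (V : J -> opens k) (t : J -> I)
    (Vt : forall j, V j `<=` U (t j)) q (c : cochain G U q) :
  cocycle c -> cocycle (refine_cochain Vt c).
Proof. by move=> h s; rewrite cech_d_refine /refine_cochain h res0. Qed.

Lemma res_cochain_eq G (I : Type) (U : I -> opens k) q (c : cochain G U q) s s' V
    (h : V `<=` cap U s) (h' : V `<=` cap U s') : s = s' -> res h (c s) = res h' (c s').
Proof. by move=> e; move: h'; rewrite -e => h'; exact: res_irr. Qed.

Lemma cohomology0_global G : nat_cohomology_dim G 0 0 -> forall s : sec G (opT k), s = 0.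
Proof.
move=> /cohomology0P H s.
pose z : cochain G (fun _ : unit => opT k) 0 := fun t => res (@subT k (cap _ t)) s.
have [||L [W [t [Wt [Wc cb]]]]] := H _ _ z; first by move=> x _; exists tt.
  move=> t; rewrite /cech_d !big_ord_recl big_ord0 addr0 /z.
  rewrite !(res_comp _ _ (@subT k (cap _ t))) expr0 expr1 scale1r scaleN1r.
  exact: subrr.
have sub (r : 'I_1 -> L) : cap W r `<=` opT k by [].
apply: (@sec_ext _ G _ _ (fun r : 'I_1 -> L => cap W r) sub).
  by move=> x _; have [l _ Wx] := Wc x I; exists (fun=> l) => // i.
move=> r; rewrite res0 -(cb r) /refine_cochain /z.
exact/esym/res_comp.
Qed.

Definition torsion_free G := forall U V (VU : V `<=` U) x, oset V x ->
  injective (res VU : sec G U -> sec G V).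

(** Cousin's problem at one point: a section near a punctured neighbourhood of [x] is the
    sum of one that is defined away from [x] and one that is defined at [x]. *)
Definition cousin G := forall W (T : opens k) x z (WP : W `<=` punctured x) (WT : W `<=` T),
  oset W z -> (forall y, oset T y -> oset W y \/ y = x) ->
  forall m : sec G W, exists (g : sec G (punctured x)) (h : sec G T),
    m = res WP g + res WT h.

(** * A vanishing criterion for Cech cohomology *)

Section Wedge.
Variables (G : omodule k) (W : opens k) (w : P1 k) (Ww : oset W w).

Lemma wedge_open x : open (oset W `|` [set x]).
Proof. exact: open_superset (oset_open W) Ww (@subsetUl _ _ _). Qed.

(** The members of the cover meet pairwise in [W]. Its intersections are therefore
    [W] or, for a constant tuple, [W] with one more point, and a cochain is a function
    into the sections over [W] with an extension condition on constant tuples. *)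
Definition wedge x : opens k := Opens (@wedge_open x).

Lemma sub_wedge x : W `<=` wedge x. Proof. by move=> y; left. Qed.

Lemma sub_cap q (s : 'I_q.+1 -> P1 k) : W `<=` cap wedge s.
Proof. by move=> y Wy i _; left. Qed.

Lemma wedge_cover : covers wedge (opT k).
Proof. by move=> x _; exists x => //; right. Qed.

Hypothesis tfG : torsion_free G.

(** For a torsion-free sheaf restriction to [W] is injective, so a cochain on the wedge
    cover is known by its germs in [sec G W]; [lifts] tells which functions of tuples
    arise in this way. *)
Definition lifts q (s : 'I_q.+1 -> P1 k) (m : sec G W) :=
  exists t, res (@sub_cap q s) t = m.

Definition extends x (m : sec G W) := exists t, res (@sub_wedge x) t = m.

Lemma lifts_const q x m : extends x m -> lifts (fun _ : 'I_q.+1 => x) m.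
Proof.
move=> [t tE]; have h : cap wedge (fun _ : 'I_q.+1 => x) `<=` wedge x.
  by move=> y /(_ ord0 I).
by exists (res h t); rewrite (res_comp _ _ (@sub_wedge x)).
Qed.

Lemma lifts_nonconst q (s : 'I_q.+1 -> P1 k) m :
  (forall x, s <> fun=> x) -> lifts s m.
Proof.
move=> ns; have [i si] : exists i, s i <> s ord0.
  apply: contrapT => h; apply: (ns (s ord0)); apply/funext => i.
  by apply: contrapT => si; apply: h; exists i.
have h : cap wedge s `<=` W.
  move=> y sy; have [//|/= yi] := sy i I; have [//|/= y0] := sy ord0 I.
  by case: si; rewrite -yi -y0.
by exists (res h m); rewrite (res_comp _ _ (@subset_refl _ _)) res_id.
Qed.

Definition gerst q (z : cochain G wedge q) (s : 'I_q.+1 -> P1 k) : sec G W :=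
  res (@sub_cap q s) (z s).

Lemma gerst_cech_d q (z : cochain G wedge q) s :
  gerst (cech_d z) s = sdiff (gerst z) s.
Proof.
rewrite /gerst res_sum; apply: eq_bigr => j _.
by rewrite resZ rres_sign (res_comp _ _ (@sub_cap q _)).
Qed.

Lemma coboundary_of_lifts q (z : cochain G wedge q.+1) (b : ('I_q.+1 -> P1 k) -> sec G W) :
  (forall s, lifts s (b s)) -> (forall s, gerst z s = sdiff b s) -> coboundary z.
Proof.
move=> lb zb; exists (fun s => projT1 (cid (lb s))) => s.
apply: (tfG (VU := @sub_cap _ s) Ww).
rewrite -/(gerst z s) zb -/(gerst (cech_d _) s) gerst_cech_d.
by apply: eq_sdiff => t; rewrite /gerst; case: cid.
Qed.

(** The cone over [w0] of a cocycle is a primitive of its germs. As the differential squares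
    to zero the cone may be corrected by any differential, and the corrected cone is a
    cochain as soon as it extends on constant tuples. *)
Lemma coboundary_from_diagonal q (z : cochain G wedge q.+1) w0
    (c : ('I_q -> P1 k) -> sec G W) : cocycle z ->
  (forall x, lifts (fun _ : 'I_q.+1 => x)
     (gerst z (scons w0 (fun=> x)) - sdiff c (fun=> x))) -> coboundary z.
Proof.
move=> zc lc.
have dz s : sdiff (gerst z) s = 0 by rewrite -gerst_cech_d /gerst zc res0.
apply: (@coboundary_of_lifts _ _ (fun s => gerst z (scons w0 s) - sdiff c s)) => s.
  have [[x ->]|ns] := pselect (exists x, s = fun=> x); first exact: lc.
  by apply: lifts_nonconst => x e; apply: ns; exists x.
rewrite sdiffB sdiffK subr0; apply/eqP; rewrite -subr_eq0.
by rewrite -sdiff_scons dz.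
Qed.

(** In positive even degree the cocycle identity on [(w, x, ..., x)] says that the cone
    takes on the diagonal the same value as the cocycle, which extends. In odd degree
    above one, repeating the first entry gives a correction that cancels the cone on the
    diagonal. *)
Lemma wedge_coboundary q (z : cochain G wedge q.+2) : cocycle z -> coboundary z.
Proof.
move=> zc; have dz s : sdiff (gerst z) s = 0 by rewrite -gerst_cech_d /gerst zc res0.
have [oq|eq] := boolP (odd q).
  apply: (@coboundary_from_diagonal _ z w
    (fun s => gerst z (scons w (scons (s ord0) s)))) => // x.
  rewrite sdiff_const /= oq /= scons_const subrr.
  by exists 0; exact: res0.
apply: (@coboundary_from_diagonal _ z w (fun=> 0)) => // x.
rewrite sdiff_const if_same subr0.
have := dz (scons w (fun=> x)); rewrite sdiff_scons sdiff_const /= (negbTE eq) /=.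
move=> /eqP; rewrite subr_eq0 => /eqP <-; apply: lifts_const.
have h : wedge x `<=` cap wedge (fun _ : 'I_q.+3 => x) by move=> y wy i _.
by exists (res h (z (fun=> x))); rewrite (res_comp _ _ (@sub_cap _ _)).
Qed.

Hypothesis coG : cousin G.

Lemma extends_sum x (I : Type) (r : seq I) (P : pred I) (m : I -> sec G W) :
  (forall i, P i -> extends x (m i)) -> extends x (\sum_(i <- r | P i) m i).
Proof.
move=> h; apply: (big_ind (extends x)) => // [|m1 m2 [t1 <-] [t2 <-]].
  by exists 0; exact: res0.
by exists (t1 + t2); exact: resD.
Qed.

Lemma cousin_point x (m : sec G W) : ~ oset W x -> exists g,
  extends x (m - g) /\ forall y, y <> x -> extends y g.
Proof.
move=> nWx; have WP : W `<=` punctured x by move=> y Wy yx; apply: nWx; rewrite -yx.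
have [|g [h ->]] := coG WP (@sub_wedge x) Ww _ m.
  by move=> y [|/= ->]; [left|right].
exists (res WP g); split; first by exists h; rewrite addrAC subrr add0r.
move=> y yx; have yP : wedge y `<=` punctured x by move=> u [/WP|/= ->].
by exists (res yP g); rewrite (res_comp _ _ WP).
Qed.

(** The singular parts are subtracted one point at a time: the correction at a point of the
    complement of [W] extends to all the others. *)
Lemma cousin_points (m : P1 k -> sec G W) : exists g, forall x, extends x (m x - g).
Proof.
have /finite_seqP[s0 s0E] := open_compl_finite (oset_open W) Ww.
pose s := undup s0.
have sP x : x \in s <-> ~ oset W x.
  rewrite mem_undup; split=> [h|h]; last by have : (~` oset W) x by []; rewrite s0E.
  by have : [set` s0] x by []; rewrite -s0E.
have g_ex x : exists g, ~ oset W x -> extends x (m x - g) /\ forall y, y <> x -> extends y g.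
  have [Wx|nWx] := pselect (oset W x); first by exists 0.
  by have [g gE] := cousin_point (m x) nWx; exists g.
have /choice[g gE] := g_ex.
exists (\sum_(x <- s) g x) => x.
have [Wx|nWx] := pselect (oset W x).
  have h : wedge x `<=` W by move=> y [|/= ->].
  by exists (res h (m x - \sum_(x <- s) g x)); rewrite (res_comp _ _ (@subset_refl _ _)) res_id.
rewrite (bigD1_seq x) ?undup_uniq //=; last exact/sP.
rewrite opprD addrA; have [[t1 t1E] _] := gE x nWx.
have [t2 t2E] : extends x (\sum_(i <- s | i != x) g i).
  rewrite big_seq_cond; apply: extends_sum => y /andP[/sP ys /eqP yx].
  by have [_] := gE y ys; apply=> /esym.
by exists (t1 - t2); rewrite resD resN t1E t2E.
Qed.

Lemma wedge_coboundary1 (z : cochain G wedge 1) : cocycle z -> coboundary z.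
Proof.
move=> zc.
have [g gE] := cousin_points (fun x => gerst z (scons w (fun=> x))).
apply: (@coboundary_from_diagonal _ z w (fun=> g)) => // x.
by rewrite sdiff_const /=; exact/lifts_const/gE.
Qed.

End Wedge.

Lemma common_open (J : Type) (V : J -> opens k) (u : P1 k -> J)
    (Vu : forall x, oset (V (u x)) x) (s : seq (P1 k)) x0 :
  exists (W : opens k) w, [/\ oset W w, W `<=` V (u x0) & forall x, x \in s -> W `<=` V (u x)].
Proof.
elim: s => [|y s [W [w [Ww W0 Ws]]]]; first by exists (V (u x0)), x0; split.
have [z [Wz Vz]] := open_meets Ww (Vu y).
exists (opI W (V (u y))), z; split=> // [v [/W0]|v] //.
by rewrite inE => /orP[/eqP -> v' []|vs v' [/(Ws v vs)]].
Qed.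

(** One member of the cover misses only finitely many points; [W] is its intersection with
    a member around each of these. *)
Lemma wedge_refinement (J : Type) (V : J -> opens k) : covers V (opT k) ->
  exists W w (Ww : oset W w) (t : P1 k -> J), forall x, wedge Ww x `<=` V (t x).
Proof.
move=> Vc; have /choice[u Vu] : forall x, exists j, oset (V j) x.
  by move=> x; have [j _ Vx] := Vc x I; exists j.
have [x0 _] : exists x0 : P1 k, True.
  by have [x _] := @P1_point k (fun=> 1) ord0 (oner_neq0 _); exists x.
have /finite_seqP[s sE] := open_compl_finite (oset_open (V (u x0))) (Vu x0).
have [W [w [Ww W0 Ws]]] := common_open Vu s x0.
exists W, w, Ww, (fun x => if pselect (oset (V (u x0)) x) then u x0 else u x) => x.
case: pselect => h y [Wy|/= ->] //; [exact: W0|apply: Ws Wy].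
by have : (~` oset (V (u x0))) x by []; rewrite sE.
Qed.

(** In degree zero a cocycle glues to a global section. In degree one the correction asked
    by [coboundary_from_diagonal] is a single section over [W], and finding it is Cousin's
    problem; in higher degree there is no obstruction. *)
Lemma acyclic G : torsion_free G -> cousin G -> (forall s : sec G (opT k), s = 0) ->
  forall q, nat_cohomology_dim G q 0.
Proof.
move=> tf co glob q; apply/cohomology0P => J V z Vc zc.
case: q z zc => [|q] z zc.
  exists J, V, id, (fun j => @subset_refl _ _); split=> // s.
  suff z0 s' : z s' = 0 by rewrite /refine_cochain z0 res0.
  have sub (s1 : 'I_1 -> J) : cap V s1 `<=` opT k by [].
  have [|r1 r2|t tE] := @sec_glue _ G (opT k) _ (fun s1 => cap V s1) sub _ z.
  - by move=> x _; have [j _ Vx] := Vc x I; exists (fun=> j) => // i.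
  - pose D := opI (cap V r1) (cap V r2).
    pose s2 (i : 'I_2) := if i == ord0 then r1 ord0 else r2 ord0.
    have D2 : D `<=` cap V s2.
      by move=> x [/(_ ord0 I) D1 /(_ ord0 I) D2] i _; rewrite /s2; case: eqP.
    have f0 : face s2 ord0 = r2 by apply/funext => i; rewrite (ord1 i).
    have f1 : face s2 (lift ord0 ord0) = r1 by apply/funext => i; rewrite (ord1 i).
    have := congr1 (res D2) (zc s2).
    rewrite /cech_d !big_ord_recl big_ord0 addr0 resD !resZ !rres_sign res0.
    rewrite !(res_comp _ _ (subset_trans D2 (@cap_face _ _ _ _ _ _))).
    rewrite expr0 expr1 scale1r scaleN1r => /eqP; rewrite subr_eq0 => /eqP e.
    apply: etrans (res_cochain_eq z _ _ (esym f1)) (etrans (esym e) _).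
    exact: res_cochain_eq f0.
  - by rewrite -tE (glob t) res0.
have [W [w [Ww [t Vt]]]] := wedge_refinement Vc.
exists (P1 k), (wedge Ww), t, Vt; split; first exact: wedge_cover.
have := cocycle_refine Vt zc.
case: q z zc => [|q] z zc; first exact: wedge_coboundary1.
exact: wedge_coboundary.
Qed.

End CechTheory.

(** * O(-1) has no cohomology *)

Section Transfer.
Variable k : closedFieldType.
Implicit Types (U V W : opens k) (F G : omodule k).

(** Unlike the vanishing of Cech cohomology that they imply, these conditions pass
    directly to isomorphic sheaves and to finite sums. *)
Definition acyclic_hyp G :=
  [/\ torsion_free G, cousin G & forall s : sec G (opT k), s = 0].

Lemma acyclic_hyp_iso F G : iso F G -> acyclic_hyp G -> acyclic_hyp F.
Proof.
move=> [phi h b] [tf co gl].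
have inj V : injective (phi V) by exact/bij_inj/b.
split=> [U V VU x Vx s t e|W T x z WP WT Wz TW m|s].
- by apply/inj/(tf _ _ VU _ Vx); rewrite -!(hom_res h) // e.
- have [g [t e]] := co _ _ _ _ WP WT Wz TW (phi W m).
  have [g' g'E] := bij_surj (b _ (@subT _ _)) g.
  have [t' t'E] := bij_surj (b _ (@subT _ _)) t.
  by exists g', t'; apply: inj; rewrite e (homD h) // !(hom_res h) // g'E t'E.
- by apply: inj; rewrite (gl (phi _ s)) (gl (phi _ 0)).
Qed.

Lemma acyclic_hyp_dsum r F : acyclic_hyp F -> acyclic_hyp (dsum r F).
Proof.
move=> [tf co gl]; split=> [U V VU x Vx s t /ffunP e|W T x z WP WT Wz TW m|s].
- by apply/ffunP => a; apply: (tf _ _ VU _ Vx); have := e a; rewrite !ffunE.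
- have ex a : exists gh : sec F (punctured x) * sec F T,
      m a = res WP gh.1 + res WT gh.2.
    by have [g [h e]] := co _ _ _ _ WP WT Wz TW (m a); exists (g, h).
  have /choice[gh ghE] := ex.
  by exists [ffun a => (gh a).1], [ffun a => (gh a).2]; apply/ffunP => a;
    rewrite !ffunE ghE.
- by apply/ffunP => a; rewrite (gl (s a)) ffunE.
Qed.

End Transfer.

Section Ominus1.
Variable k : closedFieldType.
Implicit Types (x y p : P1 k) (phi psi : P1 k -> k) (U V W : opens k).

Local Notation C0 := (chart k ord0).
Local Notation C1 := (chart k ord_max).
Local Notation O := (O_P1 k (-1)).

(** The value of a section of O(-1) on the representative of a point. *)
Definition sval U (s : sec O U) x : k :=
  if coord x ord0 == 0 then rval (tw1 s : regfun _) x / coord x ord_max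
  else rval (tw0 s : regfun _) x / coord x ord0.

Lemma sval0E U (s : sec O U) x : coord x ord0 != 0 ->
  sval s x = rval (tw0 s : regfun _) x / coord x ord0.
Proof. by rewrite /sval => /negbTE ->. Qed.

Lemma sval1E U (s : sec O U) x : oset U x -> coord x ord_max != 0 ->
  sval s x = rval (tw1 s : regfun _) x / coord x ord_max.
Proof.
move=> Ux x1; rewrite /sval; case: eqP => // /eqP x0.
have Ux01 : oset (opI U (opI C0 C1)) x by split=> //; split; exact/chartP.
have := congr1 (fun f : regfun _ => rval f x) (tw_eq s).
rewrite rvalM !rval_res // rval_trans // => ->.
by rewrite -/(tw1 s) exprN1; field; rewrite x0 x1.
Qed.

Lemma svalD U (s t : sec O U) x : sval (s + t) x = sval s x + sval t x.
Proof. by rewrite /sval; case: eqP => _; rewrite rvalD mulrDl. Qed.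

Lemma svalN U (s : sec O U) x : sval (- s) x = - sval s x.
Proof. by rewrite /sval; case: eqP => _; rewrite rvalN mulNr. Qed.

Lemma sval_res U V (VU : V `<=` U) (s : sec O U) x : oset V x ->
  sval (res VU s) x = sval s x.
Proof.
move=> Vx; have [i xi] := coord_neq0 x.
have [e|e] := ord2P i; subst i.
  by rewrite !sval0E // rval_res //; split=> //; exact/chartP.
by rewrite !sval1E ?rval_res //; [split=> //; exact/chartP|exact: VU].
Qed.

Lemma sval_inj U (s t : sec O U) :
  (forall x, oset U x -> sval s x = sval t x) -> s = t.
Proof.
move=> h; apply: twP; apply: rval_inj => x [Ux /chartP xi].
  by have := h x Ux; rewrite !sval0E // => /(mulIf _); apply; rewrite invr_eq0.
by have := h x Ux; rewrite !sval1E // => /(mulIf _); apply; rewrite invr_eq0.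
Qed.

Lemma locquot_inv_coord U i : U `<=` chart k i ->
  locquot 1 U (fun y => (coord y i)^-1).
Proof.
move=> Ui; apply: locquot_ext (locquot_quot (n := 0) (isform_const 1) _ _).
- by move=> y _; exact: mul1r.
- exact: isform_coord.
- by move=> y /Ui /chartP.
Qed.

Lemma sval_locquot U (s : sec O U) : locquot 1 U (sval s).
Proof.
apply: locquot_cover => x Ux; have [i /chartP xi] := coord_neq0 x.
exists (opI U (chart k i)); split=> //.
have [e|e] := ord2P i; subst i.
  apply: locquot_ext (locquotM (rval_locquot (tw0 s : regfun _))
    (locquot_inv_coord (@opIr k U C0))).
  by move=> y [_ /chartP y0]; rewrite sval0E.
apply: locquot_ext (locquotM (rval_locquot (tw1 s : regfun _))
  (locquot_inv_coord (@opIr k U C1))).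
by move=> y [Uy /chartP y1]; rewrite sval1E.
Qed.

Lemma locquot_form e U L phi : isform e L -> locquot e U phi ->
  locquot 0 U (fun y => phi y * L y).
Proof.
move=> hL h x /h[V [Vx [n [P [Q [hP hQ hV]]]]]]; exists V; split=> //.
exists (n + e)%N, (fun y => P y * L y), Q; rewrite addn0; split=> //.
  exact: isformM.
by move=> y /hV[Q0 ->]; rewrite mulrAC.
Qed.

Lemma sval_surj U phi : locquot 1 U phi ->
  exists s : sec O U, forall x, oset U x -> sval s x = phi x.
Proof.
move=> h.
have l0 := locquot_form (isform_coord k ord0) (locquot_sub (@opIl k U C0) h).
have l1 := locquot_form (isform_coord k ord_max) (locquot_sub (@opIl k U C1) h).
have st : (mkreg l0, mkreg l1) \in @tw_pred k (-1) (structure_sheaf k) U.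
  apply/asboolP; apply: rval_inj => x Ux01; have [Ux [/chartP x0 /chartP x1]] := Ux01.
  rewrite rvalM !rval_res // rval_trans // !rval_mkreg //; try by split=> //; exact/chartP.
  by rewrite exprN1; field; rewrite x0.
exists (TwSec st) => x Ux; have [i /chartP xi] := coord_neq0 x.
have [e|e] := ord2P i; subst i; have /chartP := xi => xi'.
  by rewrite sval0E // rval_mkreg ?mulfK.
by rewrite sval1E // rval_mkreg ?mulfK.
Qed.

Lemma Om1_torsion_free : torsion_free O.
Proof.
move=> U V VU z Vz s t e.
have st0 x : oset U x -> sval (s - t) x = 0.
  move=> Ux; apply: (locquot_vanish (sval_locquot (s - t)) Vz) => // y Vy.
  by rewrite svalD svalN -!(sval_res VU) // e subrr.
apply: sval_inj => x /st0 /eqP; rewrite svalD svalN subr_eq0; exact: eqP.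
Qed.

Lemma form_open n Q : isform n Q -> exists U : opens k, forall y, oset U y <-> Q y != 0.
Proof.
move=> [f fE]; have oU : open (basic_open f).
  by rewrite openE_P1 => y fy; exists n, f; split=> // u.
by exists (Opens oU) => y; rewrite /= /basic_open /= fE.
Qed.

(** Comparing with the quotient near [x], whose denominator does not vanish there, the
    cross products agree on an open set, hence at [x]. *)
Lemma locquot1_zero phi n P Q V v x : locquot 1 (opT k) phi -> oset V v ->
  isform n P -> isform n.+1 Q ->
  (forall y, oset V y -> Q y != 0 /\ phi y = P y / Q y) -> Q x = 0 -> P x = 0.
Proof.
move=> h Vv hP hQ hV Qx.
have [V' [V'x [n' [P' [Q' [hP' hQ' hV']]]]]] := h x I.
rewrite addn1 in hQ'; have [Q'x _] := hV' x V'x.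
have [z [Vz V'z]] := open_meets Vv V'x.
have PQ y : P y * Q' y = P' y * Q y.
  have hL := isformM hP hQ'; have hR := isformM hP' hQ.
  rewrite addnS addnC -addnS in hL.
  apply/eqP; rewrite -subr_eq0; apply/eqP.
  apply: (form_vanish (isformB hL hR) (conj Vz V'z : oset (opI V V') z)) => u [Vu V'u].
  have [Q0 e] := hV u Vu; have [Q'0 e'] := hV' u V'u.
  apply/eqP; rewrite subr_eq0 -eqr_div // -e -e'; exact/eqP.
have := PQ x; rewrite Qx mulr0 => /eqP.
by rewrite mulf_eq0 (negbTE Q'x) orbF => /eqP.
Qed.

(** A zero of the denominator is a zero of the numerator, as the quotient is regular
    there; cancelling these common zeros one by one leaves no room for a denominator
    of degree one more than the numerator. *)
Lemma locquot1_global phi : locquot 1 (opT k) phi -> forall x, phi x = 0.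
Proof.
move=> h; suff key n P Q (V : opens k) v : oset V v -> isform n P -> isform n.+1 Q ->
    (forall y, oset V y -> Q y != 0 /\ phi y = P y / Q y) ->
    forall y, oset V y -> phi y = 0.
  move=> x; have [V [Vx [n [P [Q [hP hQ hV]]]]]] := h x I.
  by rewrite addn1 in hQ; exact: (key n P Q V x).
elim: n P Q => [|n IH] P Q Vv hP hQ hV; have [x Qx] := form_has_zero hQ;
  have Px : P x = 0.
- exact: (locquot1_zero h Vv hP hQ hV).
- by have [c cE] := isform0_const hP; move=> y /hV[_ ->]; rewrite cE -(cE x) Px mul0r.
- exact: (locquot1_zero h Vv hP hQ hV).
have [P1 [hP1 P1E]] := form_div hP Px; have [Q1 [hQ1 Q1E]] := form_div hQ Qx.
apply: (IH P1 Q1) => // y /hV[Q0 ->]; rewrite P1E Q1E.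
move: Q0; rewrite Q1E mulf_eq0 negb_or => /andP[l0 Q10]; split=> //.
by rewrite -mulf_div divff // mul1r.
Qed.

Lemma Om1_global (s : sec O (opT k)) : s = 0.
Proof.
apply: sval_inj => x _; rewrite (locquot1_global (sval_locquot s)).
by rewrite (locquot1_global (sval_locquot 0)).
Qed.

Lemma form_strip x w m Q : isform m Q -> Q w != 0 -> exists j e Q',
  [/\ m = (j + e)%N, isform e Q', Q' x != 0 & forall y, Q y = lin x y ^+ j * Q' y].
Proof.
have triv n (R : P1 k -> k) : isform n R -> R x != 0 -> exists j e Q',
    [/\ n = (j + e)%N, isform e Q', Q' x != 0 & forall y, R y = lin x y ^+ j * Q' y].
  by move=> hR Rx; exists 0%N, n, R; split=> // y; rewrite mul1r.
elim: m Q => [|m IH] Q hQ Qw; have [Qx|Qx] := eqVneq (Q x) 0; try exact: triv hQ Qx.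
  by have [c cE] := isform0_const hQ; move: Qw; rewrite cE -(cE x) Qx eqxx.
have [Q1 [hQ1 Q1E]] := form_div hQ Qx.
have [|j [e [Q' [-> hQ' Q'x Q'E]]]] := IH Q1 hQ1.
  by apply: contraNneq Qw => h; rewrite Q1E h mulr0.
by exists j.+1, e, Q'; split=> // y; rewrite Q1E Q'E exprS mulrA.
Qed.

(** The polar part of a quotient at [x], peeled off one order at a time: subtracting a
    multiple of the power of a form that does not vanish at [x] makes the numerator
    vanish there. *)
Lemma polar_part x j : forall n e P Q, isform n P -> isform e Q -> Q x != 0 ->
  n.+1 = (j + e)%N -> exists g h (U : opens k),
  [/\ locquot 1 (punctured x) g, oset U x, locquot 1 U h &
      forall y, oset U y -> y <> x -> P y / (lin x y ^+ j * Q y) = g y + h y].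
Proof.
have [i xi] := coord_neq0 x.
elim: j => [|j IH] n e P Q hP hQ Qx ne; have [N NE] := form_open hQ.
  exists (fun=> 0), (fun y => P y / Q y), N; split.
  - exact: locquot0.
  - exact/NE.
  - by apply: locquot_quot hP _ _ => [|y /NE //]; rewrite addn1 ne.
  - by move=> y _ _; rewrite mul1r add0r.
(* The multiple that makes the numerator vanish at [x]. *)
pose c := P x / (coord x i ^+ j * Q x).
have hA : isform n (fun y => c * (coord y i ^+ j * Q y)).
  have -> : n = (j + e)%N by apply/eq_add_S; rewrite ne.
  apply: isformZ; apply: isformM => //.
  by have := isformX j (isform_coord k i); rewrite muln1.
have hg : locquot 1 (punctured x) (fun y => c * coord y i ^+ j / lin x y ^+ j.+1).
  apply: (@locquot_quot _ _ _ j).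
  - by apply: isformZ; have := isformX j (isform_coord k i); rewrite muln1.
  - by have := isformX j.+1 (isform_lin x); rewrite muln1 addn1.
  - by move=> y /lin_neq0 l0; rewrite expf_neq0.
have hD := isformB hP hA.
have D0 : P x - c * (coord x i ^+ j * Q x) = 0.
  by rewrite /c divfK ?subrr // mulf_neq0 // expf_neq0.
case: n hP ne hA hD => [|n] hP ne hA hD.
  (* The new numerator is constant and vanishes at [x]. *)
  have [d dE] := isform0_const hD.
  exists (fun y => c * coord y i ^+ j / lin x y ^+ j.+1), (fun=> 0), N; split.
  - exact: hg.
  - exact/NE.
  - exact: locquot0.
  - move=> y /NE Qy /lin_neq0 l0; rewrite addr0.
    have /eqP := dE y; rewrite -(dE x) D0 subr_eq0 => /eqP ->.
    by field; rewrite expf_neq0 // Qy.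
have [P1 [hP1 P1E]] := form_div hD D0.
have [|g [h [U [hg' Ux hh E]]]] := IH n e P1 Q hP1 hQ Qx; first by apply/eq_add_S.
exists (fun y => c * coord y i ^+ j / lin x y ^+ j.+1 + g y), h, (opI U N); split.
- exact: locquotD.
- by split=> //; exact/NE.
- by apply: locquot_sub hh; exact: opIl.
- move=> y [Uy /NE Qy] yx; rewrite -addrA -E //.
  have /lin_neq0 l0 := yx; have := P1E y; move/(canRL (subrK _)) => ->.
  by rewrite exprS; field; rewrite ?expf_neq0 // Qy l0.
Qed.

(** The polar part at [x] of one quotient of forms representing the section solves the
    problem: the difference is regular off [x] by assumption, and near [x] it is the
    remainder found by [polar_part]. *)
Lemma Om1_cousin : cousin O.
Proof.
move=> W T x z WP WT Wz TW m.
have [V [Vz [n [P [Q [hP hQ hV]]]]]] := sval_locquot m Wz.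
have [Qz _] := hV z Vz.
have [j [e [Q' [ne hQ' Q'x QE]]]] := form_strip x hQ Qz.
have [|g [h [U [hg Ux hh E]]]] := polar_part hP hQ' Q'x (j := j); first by rewrite -ne addn1.
have [gs gsE] := sval_surj hg.
pose hT y := if y == x then h x else sval m y - g y.
have hTl : locquot 1 T hT.
  apply: locquot_cover => y Ty; have [Wy|->] := TW y Ty.
    exists W; split=> //.
    apply: locquot_ext (locquotD (sval_locquot m) (locquotN (locquot_sub WP hg))).
    by move=> u Wu; rewrite /hT; case: eqP => // ux; have := WP _ Wu.
  pose N := opI U (wedge (Vz : oset V z) x).
  exists N; split; first by split=> //; right.
  apply: locquot_ext (locquot_sub (@opIl _ U _) hh) => u [Uu Nu].
  rewrite /hT; case: eqP => [-> //|ux].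
  have Vu : oset V u by case: Nu.
  by have [_ ->] := hV u Vu; rewrite QE E // addrAC subrr add0r.
have [hs hsE] := sval_surj hTl.
exists gs, hs; apply: sval_inj => y Wy.
rewrite svalD !sval_res // gsE; last exact: WP.
rewrite hsE; last exact: WT.
rewrite /hT; case: eqP => [yx|_]; first by have := WP _ Wy; rewrite yx => /(_ erefl).
by rewrite addrC subrK.
Qed.

Lemma acyclic_hyp_Om1 : acyclic_hyp O.
Proof. by split; [exact: Om1_torsion_free|exact: Om1_cousin|exact: Om1_global]. Qed.

End Ominus1.

(** * Multiplication by a linear form *)

Section LinearForms.
Variable k : closedFieldType.
Implicit Types (U V W : opens k) (L : P1 k -> k) (x y p : P1 k).

Local Notation C0 := (chart k ord0).
Local Notation C1 := (chart k ord_max).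
Local Notation C01 := (opI C0 C1).

Definition nonvanishing U L := forall y, oset U y -> L y != 0.

Lemma nonvanishing_coord V i : V `<=` chart k i -> nonvanishing V (fun y => coord y i).
Proof. by move=> Vi y /Vi /chartP. Qed.

Lemma nonvanishing_sub U V L : V `<=` U -> nonvanishing U L -> nonvanishing V L.
Proof. by move=> VU h y /VU; exact: h. Qed.

Definition lquot L L' (hL : isform 1 L) (hL' : isform 1 L') V (h : nonvanishing V L') :
  regfun V := mkreg (locquot_quot (n := 1) (e := 0) hL hL' h).

Lemma rval_lquot L L' (hL : isform 1 L) (hL' : isform 1 L') V (h : nonvanishing V L') x :
  oset V x -> rval (lquot hL hL' h) x = L x / L' x.
Proof. exact: rval_mkreg. Qed.

Lemma regfun_unit V (f : regfun V) : (forall y, oset V y -> rval f y != 0) ->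
  exists g : regfun V, g * f = 1.
Proof.
move=> f0; have h : locquot 0 V (fun y => (rval f y)^-1).
  apply: locquotI => x Vx.
  have [W [Wx [n [P [Q [hP hQ hW]]]]]] := rval_locquot f Vx.
  exists W; split=> //; rewrite addn0 in hQ; exists n, Q, P; rewrite addn0; split=> //.
  move=> y Wy Vy; have [Q0 e] := hW y Wy.
  have := f0 y Vy; rewrite e mulf_eq0 negb_or => /andP[P0 _]; split=> //.
  by rewrite invf_div.
exists (mkreg h); apply: rval_inj => x Vx.
by rewrite rvalM rval_mkreg // rval1 // mulVf // f0.
Qed.

Lemma regfun_open V (f : regfun V) : exists U : opens k,
  forall y, oset U y <-> oset V y /\ rval f y != 0.
Proof.
suff oU : open [set y | oset V y /\ rval f y != 0] by exists (Opens oU).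
have [[z [Vz fz]]|h] := pselect (exists z, oset V z /\ rval f z != 0); last first.
  rewrite (_ : mkset _ = set0); first exact: open0.
  by apply/seteqP; split=> // y yh; apply: h; exists y.
have [W [Wz [n [P [Q [hP hQ hW]]]]]] := rval_locquot f Vz.
have [U UP] := form_open hP.
have WV y : oset W y -> oset U y -> rval f y != 0.
  by move=> /hW[Q0 ->] /UP P0; rewrite mulf_neq0 // invr_eq0.
apply: (@open_superset _ (oset (opI V (opI W U))) _ z); first exact: oset_open.
  split=> //; split=> //; apply/UP; apply: contraNneq fz => P0.
  by have [_ ->] := hW z Wz; rewrite P0 mul0r.
by move=> y [Vy [Wy Uy]]; split=> //; exact: WV.
Qed.

Section Multiplication.
Variable G : omodule k.

Section OneForm.
Variables (L : P1 k -> k) (hL : isform 1 L).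

Let q0 V := lquot hL (isform_coord k ord0) (nonvanishing_coord (@opIr k V C0)).
Let q1 V := lquot hL (isform_coord k ord_max) (nonvanishing_coord (@opIr k V C1)).

Lemma lmul_subproof V (s : sec G V) :
  (q0 V *: res (@opIl k V C0) s, q1 V *: res (@opIl k V C1) s) \in @tw_pred k 1 G V.
Proof.
apply/asboolP; rewrite /= !resZ !(res_comp _ _ (@opIl k V C01)) scalerA.
congr (_ *: _); apply: rval_inj => x Vx; have [Ux [/chartP x0 /chartP x1]] := Vx.
have Vx0 : oset (opI V C0) x by split=> //; exact/chartP.
have Vx1 : oset (opI V C1) x by split=> //; exact/chartP.
rewrite rvalM !rval_res // rval_ratio // !rval_lquot //.
by field; rewrite x0 x1.
Qed.

(** The components of a section of the twist are its quotients by the two coordinates. *)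
Definition lmul V (s : sec G V) : sec (twist 1 G) V := TwSec (lmul_subproof s).

Lemma lmul_hom : hom_on (opT k) lmul.
Proof.
move=> V _; split=> [s t|f s|W WV s]; apply: twP;
  rewrite /= ?resD ?scalerDr ?resZ ?scalerA 1?mulrC //.
all: congr (_ *: _); last by rewrite !(res_comp _ _ (subset_trans (@opIl k W _) WV)).
all: by apply: rval_inj => x [Wx Cx]; rewrite rval_res // !rval_lquot //; split=> //; exact: WV.
Qed.

Lemma lmul_bij V : nonvanishing V L -> bijective (@lmul V).
Proof.
move=> VL.
pose i0 := lquot (isform_coord k ord0) hL (nonvanishing_sub (@opIl k V C0) VL).
pose i1 := lquot (isform_coord k ord_max) hL (nonvanishing_sub (@opIl k V C1) VL).
have iq0 : i0 * q0 V = 1.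
  apply: rval_inj => x Vx; have [Ux /chartP x0] := Vx.
  by rewrite rvalM !rval_lquot // rval1 //; field; rewrite x0 VL.
have iq1 : i1 * q1 V = 1.
  apply: rval_inj => x Vx; have [Ux /chartP x1] := Vx.
  by rewrite rvalM !rval_lquot // rval1 //; field; rewrite x1 VL.
apply: inj_surj_bij => [s t e|u].
  apply: ext_charts.
    by have := congr1 (fun u => i0 *: (tws u).1) e; rewrite /= !scalerA iq0 !scale1r.
  by have := congr1 (fun u => i1 *: (tws u).2) e; rewrite /= !scalerA iq1 !scale1r.
have [|t [t0 t1]] := glue2 (@opIl k V C0) (@opIl k V C1) (@chart_cover k V)
  (s1 := i0 *: tw0 u) (s2 := i1 *: tw1 u).
  have h : opI (opI V C0) (opI V C1) `<=` opI V C01 by move=> x [[? ?] []].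
  have := congr1 (res h) (tw_eq u); rewrite resZ -/(tw0 u) -/(tw1 u).
  rewrite (res_comp _ _ (@opIl k (opI V C0) (opI V C1))).
  rewrite (res_comp _ _ (@opIr k (opI V C0) (opI V C1))) => e.
  rewrite !resZ e scalerA; congr (_ *: _).
  apply: rval_inj => x Vx; have [[Ux /chartP x0] [_ /chartP x1]] := Vx.
  have Vx0 : oset (opI V C0) x by split=> //; exact/chartP.
  have Vx1 : oset (opI V C1) x by split=> //; exact/chartP.
  have Vx01 : oset (opI V C01) x by apply (h x).
  rewrite rvalM !rval_res // rval_trans // !rval_lquot // expr1z.
  by field; rewrite x0 VL.
exists t; apply: twP; rewrite /= ?t0 ?t1 scalerA mulrC ?iq0 ?iq1 scale1r //.
Qed.

End OneForm.

Lemma lmul_lquot L L' (hL : isform 1 L) (hL' : isform 1 L') V (h : nonvanishing V L')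
    (s : sec G V) : lmul hL s = lquot hL hL' h *: lmul hL' s.
Proof.
apply: twP; rewrite /= scalerA; congr (_ *: _); apply: rval_inj => x Vx;
  have [Ux /chartP xi] := Vx; rewrite rvalM !rval_res // !rval_lquot //;
  by field; rewrite xi h.
Qed.

End Multiplication.

End LinearForms.

(** * Lifting sections from the fibre at a point *)

Section SurjectivityAtAPoint.
Variables (k : closedFieldType) (G : omodule k).
Implicit Types (U V W : opens k) (x y p : P1 k).
Hypothesis H1 : nat_cohomology_dim G 1 0.

Local Notation G1 := (twist 1 G).

Let mul p V := @lmul k G (lin p) (isform_lin p) V.
Let mulH p : hom_on (opT k) (mul p) := lmul_hom G (isform_lin p).

Section Cocycle.
Variables (p : P1 k) (N : opens k) (Np : oset N p) (t : sec G1 N).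

Let P := punctured p.
Let Vb (i : bool) : opens k := if i then N else P.
Let NP : opI N P `<=` N := @opIl k N P.

Variables (w : sec G (opI N P)) (wE : mul p w = res NP t).

Lemma two_cover : covers Vb (opT k).
Proof.
move=> x _; have [->|/eqP xp] := eqVneq x p; first by exists true.
by exists false => //=; rewrite /P /=; exact/eqP.
Qed.

(** The cocycle of the covering of the line by a neighbourhood of [p] and the
    complement of [p] that measures the failure of [t], divided by the linear form of
    [p], to be the restriction of a section over the complement of [p]. *)
Let z : cochain G Vb 1 := fun s => resd (cap Vb s) w *+ s ord_max - resd (cap Vb s) w *+ s ord0.

Lemma z_diag (s : 'I_2 -> bool) : s ord0 = s ord_max -> z s = 0.
Proof. by rewrite /z => ->; rewrite subrr. Qed.

Lemma cap_offdiag (s : 'I_2 -> bool) : s ord0 <> s ord_max -> cap Vb s `<=` opI N P.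
Proof.
move=> e x sx; have := sx ord0 I; have := sx ord_max I.
by move: e; case: (s ord0); case: (s ord_max) => // _ /=; split.
Qed.

Lemma z_res (s : 'I_2 -> bool) (D : opens k) (h : D `<=` cap Vb s) : D `<=` opI N P ->
  res h (z s) = resd D w *+ s ord_max - resd D w *+ s ord0.
Proof.
move=> DN; have [e|/eqP e] := eqVneq (s ord0) (s ord_max).
  by rewrite z_diag // res0 e subrr.
have res_nat (b : bool) (u : sec G (cap Vb s)) : res h (u *+ b) = res h u *+ b.
  by case: b => //; exact: res0.
by rewrite /z resD resN !res_nat !(res_resd h (cap_offdiag e)).
Qed.

Lemma z_cocycle : cocycle z.
Proof.
move=> s; rewrite /cech_d !big_ord_recl big_ord0 addr0.
set j0 := ord0; set j1 := lift _ _; set j2 := lift _ _.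
have f0 : face s j0 ord0 = s j1 /\ face s j0 ord_max = s j2.
  by split; congr (s _); exact/val_inj.
have f1 : face s j1 ord0 = s j0 /\ face s j1 ord_max = s j2.
  by split; congr (s _); exact/val_inj.
have f2 : face s j2 ord0 = s j0 /\ face s j2 ord_max = s j1.
  by split; congr (s _); exact/val_inj.
have [[e1 e2]|ns] := pselect (s j0 = s j1 /\ s j1 = s j2).
  rewrite !z_diag ?res0 ?scaler0 ?addr0 //.
  - by rewrite f2.1 f2.2.
  - by rewrite f1.1 f1.2 e1.
  - by rewrite f0.1 f0.2.
have D : cap Vb s `<=` opI N P.
  move=> x sx; have := sx j0 I; have := sx j1 I; have := sx j2 I.
  by move: ns; case: (s j0); case: (s j1); case: (s j2) => //= ns; try by case: ns.
rewrite !(z_res _ D) f0.1 f0.2 f1.1 f1.2 f2.1 f2.2.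
rewrite /j1 /j2 /bump /= expr0 expr1 scale1r scaleN1r sqrrN expr1n scale1r.
set a := _ *+ s j0; set b := _ *+ s _; set c := _ *+ s _.
by rewrite opprB [a - b + _]addrC !subrKA subrr.
Qed.

(** After a refinement the cocycle is the coboundary of some [b]. Over the members lying in
    [N] take [t] minus the multiple of [b], over the others minus the multiple of [b]: these
    agree on overlaps. A member containing [p] is of the first kind. *)
Lemma lift_section : exists (s : sec G1 (opT k)) (D : opens k) (DN : D `<=` N) (h : sec G D),
  oset D p /\ res (@subT k D) s = res DN t - mul p h.
Proof.
have [L [W [u [Wu [Wc [b bE]]]]]] := (cohomology0P G 1).1 H1 _ _ z two_cover z_cocycle.
pose v (s : 'I_1 -> L) := u (s ord0).
have sN (s : 'I_1 -> L) : v s -> cap W s `<=` N.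
  by rewrite /v => us x /(_ ord0 I) /Wu; rewrite us.
pose sg s : sec G1 (cap W s) := resd (cap W s) t *+ v s - mul p (b s).
have sgE s (D : opens k) (h : D `<=` cap W s) : res h (sg s) = resd D t *+ v s - mul p (res h (b s)).
  rewrite /sg resD resN (hom_res (mulH p)) //; congr (_ - _).
  by case: (boolP (v s)) => [/sN sN'|_]; [rewrite (res_resd h sN')|rewrite res0].
have sub (s : 'I_1 -> L) : cap W s `<=` opT k by [].
have [|s s'|sig sigE] := @sec_glue _ G1 (opT k) _ (fun s => cap W s) sub _ sg.
- by move=> x _; have [l _ Wx] := Wc x I; exists (fun=> l) => // i.
- rewrite !sgE; set D := opI _ _.
  pose r (i : 'I_2) := if i == ord0 then s ord0 else s' ord0.
  have Dr : D `<=` cap W r.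
    by move=> x [/(_ ord0 I) D1 /(_ ord0 I) D2] i _; rewrite /r; case: eqP.
  have f0 : face r ord0 = s' by apply/funext => i; rewrite (ord1 i).
  have f1 : face r (lift ord0 ord0) = s by apply/funext => i; rewrite (ord1 i).
  have := congr1 (res Dr) (bE r).
  rewrite /cech_d !big_ord_recl big_ord0 addr0 resD !resZ !rres_sign.
  rewrite !(res_comp _ _ (subset_trans Dr (@cap_face _ _ _ _ _ _))).
  rewrite expr0 expr1 scale1r scaleN1r /refine_cochain.
  have hr : D `<=` cap Vb (u \o r) := subset_trans Dr (cap_refine Wu (s := r)).
  rewrite (res_comp _ _ hr).
  rewrite (res_cochain_eq b _ (@opIr k _ _) f0) (res_cochain_eq b _ (@opIl k _ _) f1).
  set b1 := res _ (b s'); set b0 := res _ (b s) => e.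
  have [vv|/eqP vv] := eqVneq (v s) (v s').
    have : b1 - b0 = 0 by rewrite -e z_diag ?res0.
    by move=> /eqP; rewrite subr_eq0 vv => /eqP ->.
  have DNP : D `<=` opI N P := subset_trans hr (cap_offdiag (s := u \o r) vv).
  have mw : mul p (resd D w) = resd D t.
    rewrite (resdE DNP) (hom_res (mulH p)) // wE.
    by rewrite (res_comp _ _ (subset_trans DNP NP)) (resdE (subset_trans DNP NP)).
  have mulb (c : bool) : mul p (resd D w *+ c) = resd D t *+ c.
    by rewrite -mw; case: c => //; exact: (hom0 (mulH p)).
  move: e; rewrite (z_res hr DNP) /= -/(v s) -/(v s') => /eqP.
  rewrite subr_eq addrAC -subr_eq opprK => /eqP /(congr1 (fun g => mul p g)).
  rewrite !(homD (mulH p)) // !mulb => e.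
  by apply/eqP; rewrite subr_eq addrAC -subr_eq opprK e addrC.
have [l _ Wp] := Wc p I; pose s := fun _ : 'I_1 => l.
have vs : v s by have := Wu l _ Wp; rewrite /v /s; case: (u l) => //= /(_ erefl).
exists sig, (cap W s), (sN s vs), (b s); split; first by move=> i _.
by rewrite -(res_irr (sub s)) sigE /sg vs (resdE (sN s vs)).
Qed.

End Cocycle.

(** Vanishing of the first cohomology enters here: it makes evaluation of global sections
    at [p] surjective. *)
Lemma global_lift p N (t : sec G1 N) : oset N p ->
  exists (s : sec G1 (opT k)) (D : opens k) (DN : D `<=` N) (h : sec G D),
    oset D p /\ res (@subT k D) s = res DN t - lmul (isform_lin p) h.
Proof.
move=> Np.
have [|w wE] := bij_surj (lmul_bij G (isform_lin p) (V := opI N (punctured p)) _)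
  (res (@opIl k N (punctured p)) t).
  by move=> y [_ /lin_neq0].
exact: lift_section wE.
Qed.

End SurjectivityAtAPoint.

(** * Frames *)

Section Trivialisation.
Variable k : closedFieldType.
Implicit Types (U V W : opens k) (x y p : P1 k) (G : omodule k).

Local Notation OO := (structure_sheaf k).

Section Sums.
Variable U : opens k.

Lemma rval_sum (I : Type) (r : seq I) (P : pred I) (f : I -> regfun U) x :
  rval (\sum_(i <- r | P i) f i) x = \sum_(i <- r | P i) rval (f i) x.
Proof. by apply: (big_morph (fun g => rval g x)) => [g h|]; rewrite ?rvalD ?rval0. Qed.

Lemma rval_prod (I : Type) (r : seq I) (P : pred I) (f : I -> regfun U) x : oset U x ->
  rval (\prod_(i <- r | P i) f i) x = \prod_(i <- r | P i) rval (f i) x.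
Proof.
by move=> Ux; apply: (big_morph (fun g => rval g x)) => [g h|]; rewrite ?rvalM ?rval1.
Qed.

Lemma rval_det n (A : 'M[regfun U]_n) x : oset U x ->
  rval (\det A) x = \det (\matrix_(i, j) rval (A i j) x).
Proof.
move=> Ux; rewrite rval_sum; apply: eq_bigr => s _.
rewrite rvalM rvalX // rvalN rval1 // rval_prod //; congr (_ * _).
by apply: eq_bigr => i _; rewrite mxE.
Qed.

End Sums.

Lemma mulmx_bij n V (A : 'M[regfun V]_n) :
  (forall y, oset V y -> rval (\det A) y != 0) -> bijective (fun v : 'rV_n => v *m A).
Proof.
move=> /regfun_unit[g gE]; exists (fun v => v *m (g *: \adj A)) => v.
  by rewrite -mulmxA -scalemxAr mul_mx_adj scale_scalar_mx gE mulmx1.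
by rewrite -mulmxA -scalemxAl mul_adj_mx scale_scalar_mx gE mulmx1.
Qed.

Section Frame.
Variables (r : nat) (F : omodule k) (sg : 'I_r -> sec F (opT k)).

Definition frame V (f : sec (dsum r OO) V) : sec F V :=
  \sum_a (f a : regfun V) *: res (@subT k V) (sg a).

Lemma frame_hom : hom_on (opT k) frame.
Proof.
move=> V _; split=> [s t|f s|W WV s]; rewrite /frame.
- by rewrite -big_split; apply: eq_bigr => a _; rewrite ffunE scalerDl.
- by rewrite scaler_sumr; apply: eq_bigr => a _; rewrite ffunE scalerA.
- rewrite res_sum; apply: eq_bigr => a _; rewrite ffunE resZ; congr (_ *: _).
  exact/esym/res_comp.
Qed.

Section Local.
Variables (U : opens k) (phi : forall V, sec F V -> sec (dsum r OO) V).
Arguments phi : clear implicits.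
Hypotheses (phiH : hom_on U phi) (phiB : forall V, V `<=` U -> bijective (phi V)).

(** The value at [x] in the fibre of [F], in coordinates of the local trivialisation. *)
Definition fibre V (s : sec F V) x : 'rV[k]_r := \row_a rval (phi V s a : regfun V) x.

Lemma fibre_res V W (WV : W `<=` V) s x : V `<=` U -> oset W x ->
  fibre (res WV s) x = fibre s x.
Proof.
by move=> VU Wx; apply/rowP => a; rewrite !mxE (hom_res phiH) // ffunE rval_res.
Qed.

Lemma fibreZ V (f : regfun V) s x : V `<=` U -> fibre (f *: s) x = rval f x *: fibre s x.
Proof. by move=> VU; apply/rowP => a; rewrite !mxE (homZ phiH) // ffunE rvalM. Qed.

Lemma fibreD V (s t : sec F V) x : V `<=` U -> fibre (s + t) x = fibre s x + fibre t x.
Proof. by move=> VU; apply/rowP => a; rewrite !mxE (homD phiH) // ffunE rvalD. Qed.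

Lemma fibre0 V x : V `<=` U -> fibre (0 : sec F V) x = 0.
Proof. by move=> VU; apply/rowP => a; rewrite !mxE (hom0 phiH) // ffunE rval0. Qed.

Lemma fibreN V (s : sec F V) x : V `<=` U -> fibre (- s) x = - fibre s x.
Proof. by move=> VU; apply/rowP => a; rewrite !mxE (homN phiH) // ffunE rvalN. Qed.

Lemma fibre_sum V (I : Type) (l : seq I) (P : pred I) (s : I -> sec F V) x : V `<=` U ->
  fibre (\sum_(i <- l | P i) s i) x = \sum_(i <- l | P i) fibre (s i) x.
Proof.
by move=> VU; apply: (big_morph (fun t => fibre t x)) => [? ?|]; rewrite ?fibreD ?fibre0.
Qed.

(** The determinant of the coordinates of the sections is a regular function, so it stays
    invertible near a point where their values form a basis. *)
Lemma fibre_frame_basis p : oset U p ->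
  \matrix_a fibre (res (@subT k U) (sg a)) p \in unitmx ->
  exists N, oset N p /\ forall V, V `<=` N -> bijective (@frame V).
Proof.
move=> Up; rewrite unitmxE unitfE => Dp.
pose A V : 'M[regfun V]_r := \matrix_(a, b) (phi V (res (@subT k V) (sg a)) b : regfun V).
have Adet V x : V `<=` U -> oset V x ->
    rval (\det (A V)) x = \det (\matrix_a fibre (res (@subT k U) (sg a)) x).
  move=> VU Vx; rewrite rval_det //; congr (\det _); apply/matrixP => a b.
  rewrite !mxE -(res_comp (@subT k U) VU) (hom_res phiH) // ffunE.
  exact: rval_res.
have [N NE] := regfun_open (\det (A U)).
exists N; split; first by apply/NE; split=> //; rewrite Adet.
move=> V VN; have VU : V `<=` U by move=> x /VN /NE[].
have [B AB BA] : bijective (fun v : 'rV_r => v *m A V).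
  apply: mulmx_bij => y Vy; rewrite Adet //.
  by have /NE[Uy] := VN y Vy; rewrite Adet.
have phiE (f : sec (dsum r OO) V) : phi V (frame f) = [ffun b => (\row_a f a *m A V) ord0 b].
  rewrite /frame (hom_sum phiH) //; apply/ffunP => b; rewrite sum_ffunE ffunE mxE.
  by apply: eq_bigr => a _; rewrite (homZ phiH) // ffunE !mxE.
apply: inj_surj_bij => [f f' e|s].
  have := congr1 (phi V) e; rewrite !phiE => /ffunP e'.
  have : \row_a f a = \row_a f' a.
    apply: (can_inj AB); apply/rowP => b; have := e' b; rewrite !ffunE => ->.
    by congr (_ _ b); apply/val_inj.
  by move=> /rowP e2; apply/ffunP => a; have := e2 a; rewrite !mxE.
exists [ffun a => B (\row_b (phi V s b : regfun V)) ord0 a].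
apply: (bij_inj (phiB VU)); rewrite phiE; apply/ffunP => b; rewrite ffunE.
set v := \row_a _; have -> : v = B (\row_b (phi V s b : regfun V)).
  by apply/rowP => a; rewrite mxE ffunE.
by rewrite BA mxE.
Qed.

End Local.
End Frame.

End Trivialisation.

(** * Bundles without cohomology *)

Section Triviality.
Variable k : closedFieldType.
Implicit Types (U V W : opens k) (x y p : P1 k).

Local Notation OO := (structure_sheaf k).

(** The quotient off [p] is extended at [p] by cancelling the linear form in the numerator of
    a local expression. *)
Lemma regfun_div N i p (f : regfun N) (Ni : N `<=` chart k i) :
  oset N p -> rval f p = 0 ->
  exists g, f = lquot (isform_lin p) (isform_coord k i) (nonvanishing_coord Ni) * g.
Proof.
move=> Np fp; have [V [Vp [n [P [Q [hP hQ hV]]]]]] := rval_locquot f Np.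
have Pp : P p = 0.
  have [Q0 /esym] := hV p Vp; rewrite fp => /eqP.
  by rewrite mulf_eq0 invr_eq0 (negbTE Q0) orbF => /eqP.
have i0 y : oset N y -> coord y i != 0 by move=> /Ni /chartP.
case: n hP hQ => [|n] hP hQ.
  have [c cE] := isform0_const hP.
  exists 0; rewrite mulr0; apply: rval_inj => x Nx; rewrite rval0.
  apply: (locquot_vanish (rval_locquot f) Vp) Nx => y /hV[_ ->].
  by rewrite cE -(cE p) Pp mul0r.
have [P1 [hP1 P1E]] := form_div hP Pp.
pose g y := if y == p then P1 p * coord p i / Q p else rval f y * (coord y i / lin p y).
have hg : locquot 0 N g.
  apply: locquot_cover => x Nx; have [->|/eqP xp] := eqVneq x p.
    exists (opI V N); split=> //.
    apply: (@locquot_ext _ _ _ (fun y => P1 y * coord y i / Q y)) => [y [Vy Ny]|].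
      rewrite /g; case: eqP => [-> //|/lin_neq0 l0].
      by have [Q0 ->] := hV y Vy; rewrite P1E; field; rewrite Q0 l0.
    apply: (@locquot_quot _ _ _ (n + 1)).
    - by apply: isformM => //; exact: isform_coord.
    - by rewrite addn0 in hQ; rewrite addn0 addn1.
    - by move=> y [/hV[]].
  exists (opI N (punctured p)); split=> //.
  apply: locquot_ext (locquotM (locquot_sub (@opIl _ _ _) (rval_locquot f))
    (locquot_quot (n := 1) (isform_coord k i) (isform_lin p) _)).
    by move=> y [Ny yp]; rewrite /g; case: eqP.
  by move=> y [_ /lin_neq0].
exists (mkreg hg); apply: rval_inj => x Nx; rewrite rvalM rval_lquot // rval_mkreg // /g.
case: eqP => [->|/lin_neq0 l0]; first by rewrite fp lin_self !mul0r.
by field; rewrite i0 // l0.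
Qed.

Variables (r : nat) (G : omodule k).

Local Notation G1 := (twist 1 G).

Section AtAPoint.
Variables (p : P1 k) (U : opens k) (Up : oset U p).
Variable phi : forall V, sec G1 V -> sec (dsum r OO) V.
Arguments phi : clear implicits.
Hypotheses (phiH : hom_on U phi) (phiB : forall V, V `<=` U -> bijective (phi V)).

Local Notation mul := (lmul (isform_lin p)).
Let mulH := lmul_hom G (isform_lin p).

(** Near [p] multiplication by the linear form is multiplication by a coordinate followed by
    that by a regular function vanishing at [p]. *)
Lemma fibre_lmul D (h : sec G D) : D `<=` U -> oset D p ->
  fibre phi (lmul (isform_lin p) h) p = 0.
Proof.
move=> DU Dp; have [i /chartP pi] := coord_neq0 p.
pose W := opI D (chart k i); have Wp : oset W p by [].
rewrite -(fibre_res phiH (@opIl k D (chart k i)) _ DU Wp) -(hom_res mulH) //.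
rewrite (lmul_lquot (isform_lin p) (isform_coord k i) (nonvanishing_coord (@opIr k D _))).
rewrite (fibreZ phiH) ?rval_lquot // ?lin_self ?mul0r ?scale0r //.
exact: subset_trans (@opIl _ _ _) DU.
Qed.

(** Off [p] the linear form is invertible; near [p] the coordinates of the section in the
    local trivialisation vanish at [p] and can be divided. *)
Lemma fibre_eq0_lmul (s : sec G1 (opT k)) :
  fibre phi (res (@subT k U) s) p = 0 -> exists t : sec G (opT k), mul t = s.
Proof.
move=> sp; have [i pi0] := coord_neq0 p; have /chartP pi := pi0.
pose N := opI U (chart k i); have Np : oset N p by [].
have NU : N `<=` U by exact: opIl.
have Ni : N `<=` chart k i by exact: opIr.
have fN a : rval (phi N (res (@subT k N) s) a : regfun N) p = 0.
  have /rowP/(_ a) : fibre phi (res (@subT k N) s) p = 0.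
    by rewrite -(res_comp (@subT k U) NU) (fibre_res phiH).
  by rewrite !mxE.
have /choice[g gE] a := regfun_div Ni Np (fN a).
have [u uE] := bij_surj (phiB NU) [ffun a => g a].
have [t1 t1E] := bij_surj (lmul_bij G (isform_coord k i) (nonvanishing_coord Ni)) u.
have t1s : mul t1 = res (@subT k N) s.
  rewrite (lmul_lquot (isform_lin p) (isform_coord k i) (nonvanishing_coord Ni)) t1E.
  apply: (bij_inj (phiB NU)); rewrite (homZ phiH) // uE.
  by apply/ffunP => a; rewrite !ffunE gE.
pose P := punctured p.
have mulP V : V `<=` P -> bijective (@lmul k G _ (isform_lin p) V).
  by move=> VP; apply: lmul_bij => y /VP /lin_neq0.
have [t2 t2E] := bij_surj (mulP P (@subset_refl _ _)) (res (@subT k P) s).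
have cov x : oset (opT k) x -> oset N x \/ oset P x.
  by move=> _; have [->|/eqP xp] := eqVneq x p; [left|right].
have [|t [tN tP]] := glue2 (@subT k N) (@subT k P) cov (s1 := t1) (s2 := t2).
  apply: (bij_inj (mulP _ (@opIr _ _ _))); rewrite !(hom_res mulH) // t1s t2E.
  by rewrite !(res_comp _ _ (@subT _ _)).
exists t; apply: (ext2 (V1U := @subT k N) (V2U := @subT k P) cov).
  by rewrite -(hom_res mulH) // tN t1s.
by rewrite -(hom_res mulH) // tP t2E.
Qed.

End AtAPoint.

Hypothesis bundle : vector_bundle r G1.
Hypothesis H0 : forall s : sec G (opT k), s = 0.
Hypothesis H1 : nat_cohomology_dim G 1 0.

Lemma fibre_inj p U (phi : forall V, sec G1 V -> sec (dsum r OO) V) (s : sec G1 (opT k)) :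
  oset U p -> hom_on U phi -> (forall V, V `<=` U -> bijective (phi V)) ->
  fibre phi (res (@subT k U) s) p = 0 -> s = 0.
Proof.
move=> Up h b /(fibre_eq0_lmul Up h b)[t <-].
by rewrite (H0 t) (hom0 (lmul_hom G (isform_lin p))).
Qed.

(** Lifting a basis of the fibre at one point [p] gives [r] global sections. A linear relation
    between their values at another point makes the corresponding combination a global
    section that vanishes there, hence zero, which contradicts independence at [p]. So the
    sections form a frame near every point. *)
Lemma twist1_trivial : iso (dsum r OO) G1.
Proof.
have [p _] : exists p : P1 k, True.
  by have [x _] := @P1_point k (fun=> 1) ord0 (oner_neq0 _); exists x.
have [U0 U0p [phi0 h0 b0]] := bundle p.
have ex (a : 'I_r) : exists s : sec G1 (opT k),
    fibre phi0 (res (@subT k U0) s) p = delta_mx ord0 a.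
  have [e eE] := bij_surj (b0 U0 (@subset_refl _ _)) [ffun b => (b == a)%:R].
  have [s [D [DU [h [Dp sE]]]]] := global_lift H1 e U0p.
  exists s; rewrite -(fibre_res h0 DU) // (res_comp _ _ (@subT k D)) sE.
  rewrite (fibreD h0) // (fibreN h0) // (fibre_lmul h0 h DU Dp) subr0 (fibre_res h0) //.
  apply/rowP => b; rewrite !mxE eE ffunE eqxx /=.
  by case: eqP => _; rewrite ?rval1 ?rval0.
have /choice[sg sgE] := ex.
apply: (local_iso (frame_hom sg)) => x.
have [U Ux [phi h b]] := bundle x.
apply: (fibre_frame_basis (sg := sg) h b Ux).
rewrite -row_free_unit; apply: inj_row_free => v vM.
pose s := \sum_a const (opT k) (v ord0 a) *: sg a.
have fs q V (psi : forall V, sec G1 V -> sec (dsum r OO) V) : hom_on V psi -> oset V q ->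
    fibre psi (res (@subT k V) s) q =
    v *m \matrix_a fibre psi (res (@subT k V) (sg a)) q.
  move=> hV Vq; rewrite res_sum (fibre_sum hV) // mulmx_sum_row; apply: eq_bigr => a _.
  by rewrite resZ (fibreZ hV) // rval_res // rval_const // rowK.
have s0 : s = 0 by apply: (fibre_inj Ux h b); rewrite fs.
have := fs p U0 phi0 h0 U0p; rewrite s0 res0 (fibre0 h0) // => e.
have e1 : \matrix_a fibre phi0 (res (@subT k U0) (sg a)) p = 1%:M.
  by apply/row_matrixP => a; rewrite rowK sgE row1.
by rewrite e e1 mulmx1.
Qed.

End Triviality.

Theorem corollary4p5 (k : closedFieldType) (char0 : [pchar k] =i pred0)
    (d : int) (d_ge1 : 1 <= d) (r : nat)
    (E : omodule k) (E_bundle : vector_bundle r E) :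
  ulrich d E <-> iso E (dsum r (O_P1 k (d - 1))).
Proof.
split=> [uE|EO q].
  pose G := twist (- d) E.
  have H0 := cohomology0_global (uE 0).
  have H1 := uE 1.
  have G1b := vector_bundle_twist 1 (vector_bundle_twist (- d) E_bundle).
  have i1 := twist_iso (d - 1) (twist1_trivial G1b H0 H1).
  have i2 : iso (twist (d - 1) (twist 1 G)) E.
    have j1 := twist_twist (d - 1) 1 G.
    have j2 := twist_twist (d - 1 + 1) (- d) E.
    have e : d - 1 + 1 + - d = 0 by rewrite subrK subrr.
    rewrite e in j2.
    apply: (iso_on_trans (iso_on_sym j1)); apply: (iso_on_trans (iso_on_sym j2)).
    exact: iso_on_sym (twist0_iso E).
  apply: (iso_on_trans (iso_on_sym i2)); apply: (iso_on_trans (iso_on_sym i1)).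
  exact: twist_dsum.
have i1 := twist_iso (- d) EO.
have i2 := twist_dsum r (- d) (O_P1 k (d - 1)).
have i3 := dsum_iso r (twist_twist (- d) (d - 1) (structure_sheaf k)).
have e : - d + (d - 1) = -1 by rewrite addrA addNr add0r.
rewrite e in i3.
have [tf co gl] := acyclic_hyp_iso (iso_on_trans i1 (iso_on_trans i2 (iso_on_sym i3)))
  (acyclic_hyp_dsum r (acyclic_hyp_Om1 k)).
by case: q => // q; exact: acyclic.
Qed.
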